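(* Assume $f_j'(u)+1\ne0$ for all $u$ and all $j$, and let $\ell\ge2$. For $P\in\mathcal M_F$ and a normalized basis $\mathcal B=\{U_0,\dots,U_k,V_0,\dots,V_k,S_1,\dots,S_k\}$ of $(T_P\mathcal M_F,g_F|_P,R_P)$ set $$\gamma_\ell=\sum_{j=1}^k\nabla^\ell R(U_0,U_j,U_j,U_0;U_j,\dots,U_j)\cdot\bigl(\nabla R(U_0,U_j,U_j,U_0;U_j)\bigr)^{\ell-2}$$ (with the convention $x^0=1$). Then: (1) $\gamma_\ell$ is independent of the normalized basis chosen, and is an $\ell$-model invariant: if $F'$ is another $k$-tuple satisfying the same hypotheses (same signs $\varepsilon_i$), $P\in\mathcal M_F$, $Q\in\mathcal M_{F'}$, and $\Phi:T_P\mathcal M_F\to T_Q\mathcal M_{F'}$ is a linear isometry with $\Phi^*(\nabla^iR)_Q=(\nabla^iR)_P$ for $0\le i\le\ell$, then $\gamma_\ell^F(P)=\gamma_\ell^{F'}(Q)$. (2) $\gamma_2=\sum_{j=1}^k\dfrac{\varepsilon_j}{(f_j'+1)^2}\Bigl(4(f_j')^2+2f_j'+6f_jf_j''-\dfrac{f_j^2f_j'''}{f_j'+1}\Bigr)$, where $f_j$ and its derivatives are evaluated at $u_j$. (3) If $\mathcal M_F$ is $\ell$-curvature homogeneous, then $\gamma_p$ is constant on $\mathcal M_F$ for $2\le p\le\ell$. (4) If $\mathcal M_F$ is locally homogeneous, then $\gamma_\ell$ is constant for all $\ell\ge2$.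
   Context: Fix an integer $k\ge 1$ and signs $\varepsilon_1,\dots,\varepsilon_k\in\{\pm1\}$. Let $f_1,\dots,f_k:\mathbb R\to\mathbb R$ be smooth, $F=(f_1,\dots,f_k)$. On $\mathbb R^{3k+2}$ with coordinates $(u_0,\dots,u_k,v_0,\dots,v_k,s_1,\dots,s_k)$ let $g_F$ be the symmetric metric whose only nonzero components on coordinate vector fields are (up to symmetry), for $1\le i\le k$ and $0\le i',j\le k$: $g_F(\partial_{u_0},\partial_{u_i})=2f_i(u_i)s_i$, $g_F(\partial_{u_i},\partial_{u_i})=-2u_0s_i$, $g_F(\partial_{u_{i'}},\partial_{v_j})=\delta_{i'j}$, $g_F(\partial_{s_i},\partial_{s_i})=\varepsilon_i$; $\mathcal M_F=(\mathbb R^{3k+2},g_F)$. $\nabla$ is the Levi-Civita connection, $R(X,Y,Z,W)=g_F(\nabla_X\nabla_YZ-\nabla_Y\nabla_XZ-\nabla_{[X,Y]}Z,W)$, $\nabla^0R=R$, and $\nabla^\ell R(X_1,\dots,X_4;Y_1,\dots,Y_\ell)=(\nabla_{Y_\ell}\nabla^{\ell-1}R)(X_1,\dots,X_4;Y_1,\dots,Y_{\ell-1})$. A normalized basis of $(T_P\mathcal M_F,g_F|_P,R_P)$ is a basis $\{U_0,\dots,U_k,V_0,\dots,V_k,S_1,\dots,S_k\}$ on which the only nonzero values of $g_F|_P$ on pairs of basis vectors are $g(U_i,V_i)=1$ ($0\le i\le k$) and $g(S_i,S_i)=\varepsilon_i$ ($1\le i\le k$), and the only nonzero values of $R_P$ on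 4-tuples of basis vectors are those obtained from $R(U_0,U_i,U_i,S_i)=1$ ($1\le i\le k$) via the curvature symmetries $R(x,y,z,w)=-R(y,x,z,w)=R(z,w,x,y)$. A pseudo-Riemannian manifold $(M,g)$ is $\ell$-curvature homogeneous if for all $P,Q\in M$ there is a linear isometry $\Phi:T_PM\to T_QM$ with $\Phi^*(\nabla^iR)_Q=(\nabla^iR)_P$ for $i=0,\dots,\ell$; it is locally homogeneous if for all $P,Q$ there is an isometry between neighborhoods of $P$ and $Q$ sending $P$ to $Q$. *)

(* Defs.v *)
From mathcomp Require Import all_boot all_order all_algebra.
From mathcomp Require Import all_classical all_reals all_analysis.
Set Implicit Arguments.
Unset Strict Implicit.
Unset Printing Implicit Defensive.
Import GRing.Theory Num.Theory.
Local Open Scope ring_scope.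

Section Model.
Variable R : realType.
Variable k : nat.

(* dimension 3k+2, coordinates ordered  u_0..u_k, v_0..v_k, s_1..s_k *)
Definition Mdim : nat := (k.+1 + k.+1 + k)%N.

(* points / tangent vectors of R^Mdim, as row vectors with their normed
   (hence topological) structure *)
Definition pt : Type :=
  matrix_matrix__canonical__normed_module_NormedModule R 1 Mdim.

Definition iU (i : 'I_k.+1) : 'I_Mdim := lshift k (lshift k.+1 i).
Definition iV (i : 'I_k.+1) : 'I_Mdim := lshift k (rshift k.+1 i).
(* S-index s : 'I_k stands for s_{s+1} *)
Definition iS (s : 'I_k) : 'I_Mdim := rshift (k.+1 + k.+1) s.

Inductive blab := LU of 'I_k.+1 | LV of 'I_k.+1 | LS of 'I_k.

Definition lab (a : 'I_Mdim) : blab :=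
  match fintype.split a with
  | inl b => match fintype.split b with inl i => LU i | inr i => LV i end
  | inr s => LS s
  end.

Definition ucoord (x : pt) (i : 'I_k.+1) : R := x ord0 (iU i).
Definition scoord (x : pt) (s : 'I_k) : R := x ord0 (iS s).

Variable F : 'I_k -> R -> R.   (* F j = f_{j+1} *)
Variable eps : 'I_k -> R.      (* eps j = epsilon_{j+1} *)

Definition gcomp (x : pt) (a b : 'I_Mdim) : R :=
  match lab a, lab b with
  | LU i, LU j =>
      match unlift ord0 i, unlift ord0 j with
      | None, Some j' => 2 * F j' (ucoord x j) * scoord x j'
      | Some i', None => 2 * F i' (ucoord x i) * scoord x i'
      | Some i', Some j' =>
          if i' == j' then - 2 * ucoord x ord0 * scoord x i' else 0
      | None, None => 0
      end
  | LU i, LV j => if i == j then 1 else 0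
  | LV j, LU i => if i == j then 1 else 0
  | LS i, LS j => if i == j then eps i else 0
  | _, _ => 0
  end.

Definition gmat (x : pt) : 'M[R]_Mdim := \matrix_(a, b) gcomp x a b.
Definition ginv (x : pt) : 'M[R]_Mdim := invmx (gmat x).

Definition gP (x X Y : pt) : R :=
  \sum_(a < Mdim) \sum_(b < Mdim) X ord0 a * gcomp x a b * Y ord0 b.

Definition pd (a : 'I_Mdim) (h : pt -> R) (x : pt) : R :=
  derive h x (delta_mx ord0 a : pt).

(* Christoffel symbols Gam c a b = Gamma^c_{ab}:  nabla_{d_a} d_b = sum_c Gamma^c_{ab} d_c *)
Definition Gam (c a b : 'I_Mdim) (x : pt) : R :=
  2^-1 * \sum_(d < Mdim) ginv x c d *
    (pd a (fun y => gcomp y b d) x + pd b (fun y => gcomp y a d) x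
     - pd d (fun y => gcomp y a b) x).

(* R(d_a, d_b) d_c = sum_f Rcoef f a b c d_f, with
   R(X,Y)Z = nabla_X nabla_Y Z - nabla_Y nabla_X Z - nabla_[X,Y] Z *)
Definition Rcoef (f a b c : 'I_Mdim) (x : pt) : R :=
  pd a (Gam f b c) x - pd b (Gam f a c) x
  + \sum_(e < Mdim) (Gam e b c x * Gam f a e x - Gam e a c x * Gam f b e x).

Definition Rcomp (x : pt) (a b c d : 'I_Mdim) : R :=
  \sum_(f < Mdim) Rcoef f a b c x * gcomp x f d.

(* covariant tensor fields, given by their components on coordinate fields *)
Definition tfield := pt -> seq 'I_Mdim -> R.

Definition Rtens : tfield := fun x l =>
  match l with [:: a; b; c; d] => Rcomp x a b c d | _ => 0 end.

(* (nabla T)(d_{a_1},...,d_{a_m}; d_b) = (nabla_{d_b} T)(d_{a_1},...,d_{a_m}),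
   the new derivative slot being the LAST one *)
Definition covd (T : tfield) : tfield := fun x l =>
  match rev l with
  | [::] => 0
  | b :: ras =>
      let as_ := rev ras in
      pd b (fun y => T y as_) x
      - \sum_(r < size as_) \sum_(c < Mdim)
          Gam c b (nth (iU ord0) as_ r) x * T x (set_nth (iU ord0) as_ r c)
  end.

Definition nablaR (m : nat) : tfield := iter m covd Rtens.

Fixpoint teval (Xs : seq pt) (t : seq 'I_Mdim -> R) : R :=
  match Xs with
  | [::] => t [::]
  | X :: Xs' => \sum_(a < Mdim) X ord0 a * teval Xs' (fun l => t (a :: l))
  end.

Definition gmodel (a b : 'I_Mdim) : R :=
  match lab a, lab b with
  | LU i, LV j => if i == j then 1 else 0
  | LV j, LU i => if i == j then 1 else 0
  | LS i, LS j => if i == j then eps i else 0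
  | _, _ => 0
  end.

(* the orbit of R(U_0,U_i,U_i,S_i) = 1 under the curvature symmetries;
   U-index lift ord0 s corresponds to S-index s *)
Definition rmodel (a b c d : 'I_Mdim) : R :=
  match lab a, lab b, lab c, lab d with
  | LU a, LU b, LU c, LS s =>
      if [&& a == ord0, b == c & b == lift ord0 s] then 1
      else if [&& b == ord0, a == c & a == lift ord0 s] then -1 else 0
  | LU a, LU b, LS s, LU c =>
      if [&& a == ord0, b == c & b == lift ord0 s] then -1
      else if [&& b == ord0, a == c & a == lift ord0 s] then 1 else 0
  | LU a, LS s, LU b, LU c =>
      if [&& a == lift ord0 s, b == ord0 & c == a] then 1
      else if [&& a == lift ord0 s, c == ord0 & b == a] then -1 else 0
  | LS s, LU a, LU b, LU c =>
      if [&& a == lift ord0 s, b == ord0 & c == a] then -1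
      else if [&& a == lift ord0 s, c == ord0 & b == a] then 1 else 0
  | _, _, _, _ => 0
  end.

(* B (iU i) = U_i, B (iV i) = V_i, B (iS s) = S_{s+1} *)
Definition normalized (P : pt) (B : 'I_Mdim -> pt) : Prop :=
  [/\ row_free (\matrix_(a < Mdim) (B a : 'rV[R]_Mdim)),
      (forall a b, gP P (B a) (B b) = gmodel a b) &
      (forall a b c d, teval [:: B a; B b; B c; B d] (nablaR 0 P)
                       = rmodel a b c d)].

Definition gamma (m : nat) (P : pt) (B : 'I_Mdim -> pt) : R :=
  \sum_(j < k)
    teval ([:: B (iU ord0); B (iU (lift ord0 j)); B (iU (lift ord0 j));
               B (iU ord0)] ++ nseq m (B (iU (lift ord0 j)))) (nablaR m P)
    * (teval [:: B (iU ord0); B (iU (lift ord0 j)); B (iU (lift ord0 j));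
                 B (iU ord0); B (iU (lift ord0 j))] (nablaR 1 P)) ^+ (m - 2).

Definition gamma2_formula (P : pt) : R :=
  \sum_(j < k)
    let u := ucoord P (lift ord0 j) in
    let f0 := F j u in
    let f1 := derive1n 1 (F j) u in
    let f2 := derive1n 2 (F j) u in
    let f3 := derive1n 3 (F j) u in
    eps j / (f1 + 1) ^+ 2
      * (4 * f1 ^+ 2 + 2 * f1 + 6 * f0 * f2 - f0 ^+ 2 * f3 / (f1 + 1)).

End Model.

Section Hom.
Variable R : realType.
Variable k : nat.

Definition smoothR (f : R -> R) : Prop :=
  forall (m : nat) (x : R), derivable (derive1n m f) x 1.

Definition admissible (F : 'I_k -> R -> R) : Prop :=
  (forall j, smoothR (F j)) /\ (forall j u, derive1n 1 (F j) u + 1 != 0).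

Definition model_iso (F F' : 'I_k -> R -> R) (eps : 'I_k -> R) (l : nat)
    (P Q : pt R k) (M : 'M[R]_(Mdim k)) : Prop :=
  [/\ M \in unitmx,
      (forall X Y : pt R k,
         gP F' eps Q ((X : 'rV[R]_(Mdim k)) *m M) ((Y : 'rV[R]_(Mdim k)) *m M)
         = gP F eps P X Y) &
      (forall i, (i <= l)%N -> forall Xs : seq (pt R k), size Xs = (4 + i)%N ->
         teval (map (fun X : pt R k => ((X : 'rV[R]_(Mdim k)) *m M : pt R k)) Xs)
               (nablaR F' eps i Q)
         = teval Xs (nablaR F eps i P))].

Definition curv_hom (F : 'I_k -> R -> R) (eps : 'I_k -> R) (l : nat) : Prop :=
  forall P Q : pt R k, exists M, model_iso F F eps l P Q M.

Fixpoint iterD (vs : seq (pt R k)) (f : pt R k -> pt R k) : pt R k -> pt R k :=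
  match vs with
  | [::] => f
  | v :: vs' => fun x => derive (iterD vs' f) x v
  end.

Definition smooth_on (U : set (pt R k)) (f : pt R k -> pt R k) : Prop :=
  forall vs x, U x -> differentiable (iterD vs f) x.

Definition loc_hom (F : 'I_k -> R -> R) (eps : 'I_k -> R) : Prop :=
  forall P Q : pt R k, exists (U V : set (pt R k)) (phi psi : pt R k -> pt R k),
    [/\ open U, open V, U P, V Q & phi P = Q] /\
    [/\ (forall x, U x -> V (phi x)), (forall y, V y -> U (psi y)),
        (forall x, U x -> psi (phi x) = x) & (forall y, V y -> phi (psi y) = y)] /\
    [/\ smooth_on U phi, smooth_on V psi &
        (forall x, U x -> forall X Y : pt R k,
           gP F eps (phi x) (derive phi x X) (derive phi x Y) = gP F eps x X Y)].

End Hom.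

(* Main.v *)
Require Import Defs.
From mathcomp Require Import all_boot all_order all_algebra.
From mathcomp Require Import all_classical all_reals all_analysis.
From mathcomp Require Import ring lra.
Set Implicit Arguments.
Unset Strict Implicit.
Unset Printing Implicit Defensive.
Import Order.TTheory GRing.Theory Num.Theory numFieldNormedType.Exports.
Local Open Scope ring_scope.

(* Let omega_j = du_0 /\ du_j and sigma_j = du_j /\ ds_j.  The Christoffel symbols
   of g_F only have components on the d_v and d_s, and for every m
     nabla^m R = sum_j (A_m (omega_j.sigma_j + sigma_j.omega_j) - B_m omega_j.omega_j) (x) du_j^m
   with A_0 = f_j' + 1, B_0 = eps_j f_j^2, A_{m+1} = A_m', B_{m+1} = B_m' + 2 eps_j f_j A_m.
   A normalized basis is rigid: the V's lie in the span of the d_v, and there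
   are a permutation pi and scalars p, c_j such that, modulo terms that the
   tensors below do not see, U_j = c_j^-1 d_{u_pi(j)}, U_0 = p d_{u_0} + ... and
   p (f_pi(j)' + 1) = +- c_j^2; R(U_0,U_j,U_j,U_0) = 0 fixes the d_s-components
   of U_0.  Hence nabla^m R(U_0,U_j,U_j,U_0;U_j,..,U_j) = c_j^(2-m) C_m with
     C_m = (B_m - eps f^2 A_m / (f' + 1)) / (f' + 1)^2   at the index pi(j),
   so that gamma_m = sum_j C_m C_1^(m-2) for every normalized basis.
   An l-model isomorphism maps normalized bases to normalized bases, which gives
   the invariance; a local isometry phi induces an l-model isomorphism for all l,
   as its second derivatives are the difference of the Christoffel symbols
   (Koszul formula) and its third derivatives are symmetric. *)

(** * Directional derivatives and the symmetry of second derivatives *)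

(** The shape of [gamma] answers the freedom left in a normalized basis: indices with equal signs
    may be permuted, hence the sum over [j]; each [U_j] is fixed only up to a factor, hence the
    power of the first-order value, whose weight in that factor is opposite to that of the value of
    order [m]. So two bases are never compared directly: [gamma] is computed in an arbitrary one,
    and the result depends on the point alone. The inverse metric is never computed. Christoffel
    symbols are identified after lowering their upper index, by nondegeneracy, and the same device
    determines the second derivatives of a local isometry. Curvature and its covariant derivatives
    are given by coordinate formulas, so even the tensor law of [R] under an isometry has to be
    derived. This is what calls for the symmetry of second and third derivatives. *)

Section Calculus.
Local Open Scope classical_set_scope.
Variables (R : realType) (V : normedModType R).
Implicit Types (h g : V -> R) (x v w : V).

(** Value and full differentiability travel together: composition requires the latter, and the rules
    below can then assemble the value by unification. *)
Definition hasD h x v (d : R) := differentiable h x /\ 'D_v h x = d.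

Lemma hasD_cst (c : R) x v : hasD (fun _ => c) x v 0.
Proof. by split; [exact: differentiable_cst | exact: derive_cst]. Qed.

Lemma hasDD h g x v a b :
  hasD h x v a -> hasD g x v b -> hasD (fun y => h y + g y) x v (a + b).
Proof.
move=> [hx <-] [gx <-]; split; first exact: (differentiableD hx gx).
by rewrite -deriveD //; exact: diff_derivable.
Qed.

Lemma hasDN h x v a : hasD h x v a -> hasD (fun y => - h y) x v (- a).
Proof.
move=> [hx <-]; split; first exact: (differentiableN hx).
by rewrite -deriveN //; exact: diff_derivable.
Qed.

Lemma hasDM h g x v a b : hasD h x v a -> hasD g x v b ->
  hasD (fun y => h y * g y) x v (a * g x + h x * b).
Proof.
move=> [hx <-] [gx <-]; split; first exact: (differentiableM hx gx).
rewrite (_ : (fun y => _) = h * g) // deriveM; [|exact: diff_derivable..].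
by rewrite addrC [X in X + _]mulrC.
Qed.

Lemma hasD_sum n (h : 'I_n -> V -> R) x v (a : 'I_n -> R) :
  (forall i, hasD (h i) x v (a i)) ->
  hasD (fun y => \sum_(i < n) h i y) x v (\sum_(i < n) a i).
Proof.
move=> H; rewrite (_ : (fun y => _) = \sum_(i < n) h i); last first.
  by apply/funext => y; rewrite fct_sumE.
split; first by apply: differentiable_sum => i; have [] := H i.
rewrite derive_sum => [|i]; last by apply: diff_derivable; have [] := H i.
by apply: eq_bigr => i _; have [] := H i.
Qed.

Lemma hasD_comp1 (f : R -> R) h x v a : derivable f (h x) 1 ->
  hasD h x v a -> hasD (fun y => f (h y)) x v (derive1 f (h x) * a).
Proof.
move=> /derivable1_diffP fx [hx <-]; rewrite -/(f \o h).
have fhx : differentiable (f \o h) x by exact: differentiable_comp.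
split=> //; rewrite deriveE // diff_comp //= -(deriveE v hx) derive1E'//.
by rewrite -[in LHS](mulr1 ('D_v h x)) [LHS]linearZ /= mulrC.
Qed.

Lemma hasD_eq h x v a b : hasD h x v a -> a = b -> hasD h x v b.
Proof. by move=> ? <-. Qed.

Lemma hasD_derive h x v a : hasD h x v a -> 'D_v h x = a.
Proof. by case. Qed.

Lemma differentiable_hasD h x v : differentiable h x -> hasD h x v ('D_v h x).
Proof. by []. Qed.

Lemma is_derive_line h (y v : V) (s : R) : differentiable h (s *: v + y) ->
  is_derive s 1 (fun s : R => h (s *: v + y)) ('D_v h (s *: v + y)).
Proof.
move=> hd.
have ld : is_diff s (( *:%R^~ v : R -> V) + cst y) (( *:%R^~ v : R -> V) + 0).
  exact: is_diffD.
have E : (fun s : R => s *: v + y) = ( *:%R^~ v : R -> V) + cst y by [].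
rewrite -/(h \o (fun s : R => s *: v + y)) E.
have hl : differentiable (h \o (( *:%R^~ v : R -> V) + cst y)) s.
  by apply: differentiable_comp.
split; first exact: diff_derivable.
by rewrite deriveE // diff_comp //= diff_val deriveE //= addr0 scale1r.
Qed.

Lemma near_differential h x (e : R) : differentiable h x -> 0 < e ->
  \forall z \near (0 : V), `|h (z + x) - h x - 'd h x z| <= e * `|z|.
Proof.
move=> /diff_locallyP[_ /eqaddoP H] e0; move: (H _ e0); apply: filterS => z /=.
by rewrite opprD addrA.
Qed.

(* The mean value theorem along [v], then the differentiability of [k] at [x]. *)
Lemma second_difference h k x v w (e : R) :
  (\forall y \near x, hasD h y v (k y)) -> differentiable k x ->
  0 < e ->
  \forall t \near 0^'+,
    `|h (t *: v + (t *: w + x)) - h (t *: v + x) - h (t *: w + x) + h x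
      - t * t * 'D_w k x| <= e * (t * t).
Proof.
move=> hd kd e0.
(* [t * N] bounds the norm of [s *: v + t *: w] for [0 <= s <= t]; the summand 1 keeps [N] positive
   when both vectors vanish. *)
set N := `|v| + `|w| + 1.
have N0 : 0 < N by rewrite /N ltr_wpDl // addr_ge0.
(* Two first-order estimates of [k] at distance at most [t * N] are subtracted, each costing
   [e * t / 2]; the mean value theorem supplies the other factor [t]. *)
have e'0 : 0 < e / (2 * N) by rewrite divr_gt0 // mulr_gt0.
have /nbhs_ballP[r1 /= r10 Hk] := near_differential kd e'0.
move/nbhs_ballP : hd => [r2 /= r20 Hh].
set r := Num.min r1 r2.
have r0 : 0 < r by rewrite lt_min r10.
near=> t.
have t0 : 0 < t by near: t; exact: nbhs_right_gt.
have tr : t * N < r.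
  by rewrite -ltr_pdivlMr //; near: t; apply: nbhs_right_lt; rewrite divr_gt0.
(* The flag [b] switches the shift by [t *: w] on and off, so that both ends of the difference are
   treated at once. *)
have small (s : R) (b : bool) : 0 <= s <= t -> `|s *: v + (if b then t else 0) *: w| <=
    t * N.
  move=> /andP[s0 st]; apply: (le_trans (ler_normD _ _)); rewrite !normrZ.
  rewrite (ger0_norm s0) /N !mulrDr mulr1.
  have -> : `|if b then t else 0| * `|w| <= t * `|w| -> s * `|v| +
      `|if b then t else 0| * `|w| <= t * `|v| + t * `|w| + t.
    move=> tw; rewrite -[leLHS]addr0 lerD ?(ltW t0) // lerD // ler_wpM2r //.
  by [].
  by apply: ler_wpM2r => //; case: b; rewrite ?normr0 ?gtr0_norm // ltW.
have hdiff : forall s b, 0 <= s <= t -> hasD h (s *: v + ((if b then t else 0) *: w +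
    x)) v (k (s *: v + ((if b then t else 0) *: w + x))).
  move=> s b st; apply: Hh; rewrite -ball_normE /ball_ /=
      addrA opprD addrCA subrr addr0 normrN.
  by apply: (le_lt_trans (small s b st)); apply: (lt_le_trans tr); rewrite ge_min lexx orbT.
have kapprox : forall s b, 0 <= s <= t ->
   `|k (s *: v + ((if b then t else 0) *: w + x)) - k x - (s * 'd k x v +
       (if b then t else 0) * 'd k x w)| <= e / (2 * N) * (t * N).
  move=> s b st.
  have lin : s * 'd k x v + (if b then t else 0) * 'd k x w = 'd k x (s *: v +
      (if b then t else 0) *: w).
    by rewrite linearD !linearZ.
  rewrite lin addrA; apply: (le_trans (Hk _ _)).
    rewrite -ball_normE /ball_ /= sub0r normrN.
    by apply: (le_lt_trans (small s b st)); apply: (lt_le_trans tr); rewrite ge_min lexx.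
  by apply: ler_wpM2l; [exact: ltW | exact: small].
pose phi s := h (s *: v + (t *: w + x)) - h (s *: v + x).
have hdiff1 : forall s, 0 <= s <= t -> hasD h (s *: v + (t *: w + x)) v (k (s *: v +
    (t *: w + x))).
  by move=> s; exact: (hdiff s true).
have hdiff0 : forall s, 0 <= s <= t -> hasD h (s *: v + x) v (k (s *: v + x)).
  by move=> s st; have := hdiff s false st; rewrite scale0r add0r.
have phid : forall s, 0 <= s <= t -> is_derive s 1 phi (k (s *: v + (t *: w + x)) -
    k (s *: v + x)).
  move=> s st; apply: is_deriveB; [have [H <-] := hdiff1 s st|have [H <-] :=
      hdiff0 s st]; exact: is_derive_line.
have [||c] := @MVT _ phi (fun s => k (s *: v + (t *: w + x)) - k (s *: v + x)) 0 t t0.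
- by move=> s; rewrite in_itv /= => /andP[/ltW s0 /ltW st]; apply: phid; rewrite s0.
- apply: derivable_within_continuous => s; rewrite in_itv /= => st.
  by have [] := phid s st.
rewrite in_itv /= => /andP[/ltW c0 /ltW ct].
rewrite /phi !scale0r !add0r subr0 => E.
have c0t : 0 <= c <= t by rewrite c0.
have := kapprox c true c0t; have := kapprox c false c0t.
rewrite /= scale0r add0r mul0r addr0 (deriveE w kd).
have -> : e / (2 * N) * (t * N) = e * t / 2.
  by field; rewrite gt_eqF.
have -> : h (t *: v + (t *: w + x)) - h (t *: v + x) - h (t *: w + x) + h x =
   (k (c *: v + (t *: w + x)) - k (c *: v + x)) * t.
  by rewrite -E; ring.
move=> A B.
have -> : (k (c *: v + (t *: w + x)) - k (c *: v + x)) * t - t * t * 'd k x w =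
  t * ((k (c *: v + (t *: w + x)) - k x - (c * 'd k x v + t * 'd k x w)) -
       (k (c *: v + x) - k x - c * 'd k x v)).
  by ring.
rewrite normrM (gtr0_norm t0) mulrCA ler_wpM2l ?(ltW t0) //.
apply: (le_trans (ler_normB _ _)); lra.
Unshelve. all: by end_near. Qed.

Lemma near_right_ex2 (P Q : R -> Prop) :
  (\forall t \near 0^'+, P t) -> (\forall t \near 0^'+, Q t) ->
  exists t : R, [/\ 0 < t, P t & Q t].
Proof.
move=> HP HQ; near (0 : R)^'+ => t; exists t; split; near: t => //.
exact: nbhs_right_gt.
Unshelve. all: by end_near. Qed.

(** The second difference is symmetric in [v] and [w], and divided by [t * t] it is within any [e]
    of either derivative. The first derivatives need only be differentiable at the single point
    [x]. *)
Lemma derive_comm h k l x v w :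
  (\forall y \near x, hasD h y v (k y)) -> (\forall y \near x, hasD h y w (l y)) ->
  differentiable k x -> differentiable l x -> 'D_w k x = 'D_v l x.
Proof.
move=> hv hw vd wd; apply/eqP; rewrite -subr_eq0 -normr_eq0 eq_le normr_ge0 andbT.
apply/ler_addgt0Pr => e e0; rewrite add0r.
have e20 : 0 < e / 2 by rewrite divr_gt0.
have Hv := second_difference w hv vd e20.
have Hw := second_difference v hw wd e20.
have [t [t0 Ht1 Ht2]] := near_right_ex2 Hv Hw.
have tt0 : 0 < t * t := mulr_gt0 t0 t0.
move: Ht1 Ht2; rewrite [t *: w + (t *: v + x)]addrCA.
move: ('D_w k x) ('D_v l x) => L L'.
move: (h (t *: v + (t *: w + x))) (h (t *: v + x)) (h (t *: w + x)) (h x).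
move=> D D1 D2 D0 H1 H2.
suff : `|(L - L') * (t * t)| <= e * (t * t).
  by rewrite normrM (gtr0_norm tt0) ler_pM2r.
have -> : (L - L') * (t * t) =
   (D - D2 - D1 + D0 - t * t * L') - (D - D1 - D2 + D0 - t * t * L) by ring.
apply: (le_trans (ler_normB _ _)).
rewrite (splitr e) addrC mulrDl; exact: lerD.
Unshelve. all: by end_near. Qed.

End Calculus.

(** * Smooth functions of one variable *)

Section Smooth.
Variable R : realType.
Implicit Types f g : R -> R.

(** Smoothness to finite order. The Leibniz rule multiplies a derivative of order [m] by an
    undifferentiated factor of order [m.+1], so the induction for products needs an order that
    [diffnW] can lower. *)
Fixpoint diffn (m : nat) f : Prop :=
  (forall x, derivable f x 1) /\ if m is m'.+1 then diffn m' (derive1 f) else True.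

Lemma smoothR_diffn f : smoothR f <-> forall m, diffn m f.
Proof.
split=> [sf m|df m].
  have : forall i x, derivable (derive1n i f) x 1 by exact: sf.
  elim: m f {sf} => [|m IH] f sf /=; split=> //; try exact: (sf 0%N).
  by apply: IH => i x; rewrite -derive1Sn; exact: sf.
elim: m f df => [|m IH] f df x; first by have [] := df 0%N.
by rewrite derive1Sn; apply: IH => i; have [] := df i.+1.
Qed.

Lemma derive1D_fun f g : (forall x, derivable f x 1) -> (forall x, derivable g x 1) ->
  derive1 (fun u => f u + g u) = (fun u => derive1 f u + derive1 g u).
Proof.
move=> df dg; apply/funext => u; rewrite !derive1E.
exact: (deriveD (df u) (dg u)).
Qed.

Lemma derive1M_fun f g : (forall x, derivable f x 1) -> (forall x, derivable g x 1) ->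
  derive1 (fun u => f u * g u) = (fun u => derive1 f u * g u + f u * derive1 g u).
Proof.
move=> df dg; apply/funext => u.
rewrite !derive1E; apply: etrans (deriveM (df u) (dg u)) _.
by rewrite addrC [X in X + _]mulrC.
Qed.

Lemma diffnD m f g : diffn m f -> diffn m g -> diffn m (fun u => f u + g u).
Proof.
elim: m f g => [|m IH] f g [df cf] [dg cg].
  by split; [move=> x; exact: (derivableD (df x) (dg x)) | exact: I].
split; first by move=> x; exact: (derivableD (df x) (dg x)).
by rewrite (derive1D_fun df dg); exact: IH cf cg.
Qed.

Lemma diffnW m f : diffn m.+1 f -> diffn m f.
Proof.
elim: m f => [|m IH] f; first by move=> [df _]; split; [exact: df | exact: I].
by move=> [df H]; split; [exact: df | exact: IH H].
Qed.

Lemma diffnM m f g : diffn m f -> diffn m g -> diffn m (fun u => f u * g u).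
Proof.
elim: m f g => [|m IH] f g; first by move=> [df _] [dg _]; split; [move=> x;
    exact: (derivableM (df x) (dg x)) | exact: I].
move=> f1 g1; have [df cf] := f1; have [dg cg] := g1.
split; first by move=> x; exact: (derivableM (df x) (dg x)).
rewrite (derive1M_fun df dg); apply: diffnD.
  exact: (IH _ _ cf (diffnW g1)).
exact: (IH _ _ (diffnW f1) cg).
Qed.

Lemma smoothRD f g : smoothR f -> smoothR g -> smoothR (fun u => f u + g u).
Proof. by rewrite !smoothR_diffn => df dg m; exact: diffnD. Qed.

Lemma smoothRM f g : smoothR f -> smoothR g -> smoothR (fun u => f u * g u).
Proof. by rewrite !smoothR_diffn => df dg m; exact: diffnM. Qed.

Lemma smoothR_cst (c : R) : smoothR (fun _ => c).
Proof.
apply/smoothR_diffn => m; elim: m c => [|m IH] c; split; [|exact: I| |];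
  try (move=> x; exact: derivable_cst).
rewrite (_ : derive1 _ = fun _ => 0); first exact: IH.
by apply/funext => u; rewrite derive1E derive_cst.
Qed.

Lemma smoothR_derive1 f : smoothR f -> smoothR (derive1 f).
Proof. by move=> sf m x; rewrite -derive1Sn; exact: sf. Qed.

Lemma smoothR_derivable f x : smoothR f -> derivable f x 1.
Proof. by move=> /(_ 0%N x). Qed.

End Smooth.

(** * The metric and its Christoffel symbols *)

Section Indices.
Variables (R : realType) (k : nat).
Notation I := 'I_(Mdim k).
Implicit Types (a b c d : I) (j : 'I_k).

Definition dl a b : R := (a == b)%:R.
Definition u0 : I := iU ord0.
Definition v0 : I := iV ord0.
Definition uj j : I := iU (lift ord0 j).
Definition vj j : I := iV (lift ord0 j).
Definition sj j : I := iS j.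

Lemma lab_iU i : lab (iU i : I) = LU i.
Proof. by rewrite /lab /iU (unsplitK (inl _ : 'I__ + 'I__)) (unsplitK (inl _ : 'I__ +
    'I__)). Qed.
Lemma lab_iV i : lab (iV i : I) = LV i.
Proof. by rewrite /lab /iV (unsplitK (inl _ : 'I__ + 'I__)) (unsplitK (inr _ : 'I__ +
    'I__)). Qed.
Lemma lab_iS s : lab (iS s : I) = LS s.
Proof. by rewrite /lab /iS (unsplitK (inr _ : 'I__ + 'I__)). Qed.

Lemma iU_inj : injective (@iU k). 
Proof. by move=> i j /lshift_inj /lshift_inj. Qed.
Lemma iV_inj : injective (@iV k). 
Proof. by move=> i j /lshift_inj /rshift_inj. Qed.
Lemma iS_inj : injective (@iS k). 
Proof. by move=> i j /rshift_inj. Qed.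

Variant index_spec : I -> Type :=
| IndexU0 : index_spec u0 | IndexU j : index_spec (uj j)
| IndexV0 : index_spec v0 | IndexV j : index_spec (vj j)
| IndexS j : index_spec (sj j).

Lemma indexP a : index_spec a.
Proof.
rewrite -(splitK a); case: (fintype.split a) => [b|s] /=; last exact: IndexS.
rewrite -(splitK b); case: (fintype.split b) => i /=.
  by case: (unliftP ord0 i) => [j ->|->]; [exact: (IndexU j)|exact: IndexU0].
by case: (unliftP ord0 i) => [j ->|->]; [exact: (IndexV j)|exact: IndexV0].
Qed.

Lemma lab_eq a b : lab a <> lab b -> dl a b = 0.
Proof. by move=> H; rewrite /dl; case: eqP => // E; case: H; rewrite E. Qed.

Lemma dl_refl a : dl a a = 1.
Proof. by rewrite /dl eqxx. Qed.
Lemma dl_uu i j : dl (uj i) (uj j) = (i == j)%:R.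
Proof. by rewrite /dl /uj (inj_eq iU_inj) (inj_eq lift_inj). Qed.
Lemma dl_vv i j : dl (vj i) (vj j) = (i == j)%:R.
Proof. by rewrite /dl /vj (inj_eq iV_inj) (inj_eq lift_inj). Qed.
Lemma dl_ss i j : dl (sj i) (sj j) = (i == j)%:R.
Proof. by rewrite /dl /sj (inj_eq iS_inj). Qed.
Lemma dl_u0u j : dl u0 (uj j) = 0.
Proof. by rewrite /dl /uj (inj_eq iU_inj) eq_liftF. Qed.
Lemma dl_uu0 j : dl (uj j) u0 = 0.
Proof. by rewrite /dl eq_sym -/(dl _ _) dl_u0u. Qed.
Lemma dl_v0v j : dl v0 (vj j) = 0.
Proof. by rewrite /dl /vj (inj_eq iV_inj) eq_liftF. Qed.
Lemma dl_vv0 j : dl (vj j) v0 = 0.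
Proof. by rewrite /dl eq_sym -/(dl _ _) dl_v0v. Qed.
Lemma dl_UV i i' : dl (iU i) (iV i') = 0.
Proof. by apply: lab_eq; rewrite lab_iU lab_iV. Qed.
Lemma dl_VU i i' : dl (iV i) (iU i') = 0.
Proof. by apply: lab_eq; rewrite lab_iU lab_iV. Qed.
Lemma dl_US i i' : dl (iU i) (iS i') = 0.
Proof. by apply: lab_eq; rewrite lab_iU lab_iS. Qed.
Lemma dl_SU i i' : dl (iS i) (iU i') = 0.
Proof. by apply: lab_eq; rewrite lab_iU lab_iS. Qed.
Lemma dl_VS i i' : dl (iV i) (iS i') = 0.
Proof. by apply: lab_eq; rewrite lab_iV lab_iS. Qed.
Lemma dl_SV i i' : dl (iS i) (iV i') = 0.
Proof. by apply: lab_eq; rewrite lab_iV lab_iS. Qed.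
Definition dlE := (dl_refl, dl_uu, dl_vv, dl_ss, dl_u0u, dl_uu0, dl_v0v, dl_vv0,
  dl_UV, dl_VU, dl_US, dl_SU, dl_VS, dl_SV).

Lemma sum_delta n (i : 'I_n) (h : 'I_n -> R) : \sum_(l < n) (i == l)%:R * h l = h i.
Proof.
rewrite (bigD1 i) //= eqxx mul1r big1 ?addr0 // => j /negbTE ji.
by rewrite eq_sym ji mul0r.
Qed.

Lemma sum_dl p (h : I -> R) : \sum_c h c * dl c p = h p.
Proof.
rewrite -[RHS](sum_delta p h); apply: eq_bigr => c _.
by rewrite /dl eq_sym mulrC.
Qed.

Lemma single_delta n (i : 'I_n) (h : 'I_n -> R) :
  (forall l, (i == l) = false -> h l = 0) -> \sum_(l < n) h l = h i.
Proof.
move=> H; rewrite (bigD1 i) //= big1 ?addr0 // => l /negbTE li.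
by apply: H; rewrite eq_sym.
Qed.

End Indices.

Section Metric.
Variables (R : realType) (k : nat) (F : 'I_k -> R -> R) (eps : 'I_k -> R).
Notation I := 'I_(Mdim k).
Notation dl := (@dl R k).
Notation u0 := (u0 k). Notation v0 := (v0 k).
Implicit Types (a b c d e : I) (i j : 'I_k) (x : pt R k).

(** Turns the case analysis on labels into a polynomial in Kronecker deltas: from here on,
    derivatives and contractions are a matter of [sum_dl] and [ring]. *)
Lemma gcompE x a b : gcomp F eps x a b = dl a u0 * dl b v0 + dl a v0 * dl b u0 +
  \sum_(j < k) (dl a (uj j) * dl b (vj j) + dl a (vj j) * dl b (uj j)
    + eps j * dl a (sj j) * dl b (sj j)
    + 2 * F j (x ord0 (uj j)) * x ord0 (sj j) * (dl a u0 * dl b (uj j) +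
        dl a (uj j) * dl b u0)
    - 2 * x ord0 u0 * x ord0 (sj j) * dl a (uj j) * dl b (uj j)).
Proof.
case: (indexP a) => [|i||i|i]; case: (indexP b) => [|i'||i'|i'];
rewrite /gcomp /ucoord /scoord ?(lab_iU, lab_iV, lab_iS) ?liftK ?unlift_none;
rewrite ?(inj_eq lift_inj) ?eqxx ?eq_liftF -?/(uj _) -?/(sj _) -?/u0;
try (rewrite big1 => [|j _]; rewrite !dlE; ring);
try (rewrite (single_delta (i:=i')) => [|j ij]; rewrite !dlE ?ij ?eqxx /=; ring);
try (rewrite (single_delta (i:=i)) => [|j ij]; rewrite !dlE ?ij ?eqxx /=; ring).
all: rewrite (single_delta (i:=i)) => [|j ij]; rewrite !dlE ?eqxx ?ij /=; try ring.
all: rewrite ?[i' == i]eq_sym; case: (eqVneq i i') => [->|_] /=; ring.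
Qed.
End Metric.

Section Curvature.
Variables (R : realType) (k : nat) (F : 'I_k -> R -> R) (eps : 'I_k -> R).
Notation I := 'I_(Mdim k).
Notation dl := (@dl R k).
Notation u0 := (u0 k). Notation v0 := (v0 k).
Implicit Types (a b c d e : I) (i j : 'I_k) (x : pt R k).

Definition co x a : R := x ord0 a.
Definition bvec a : pt R k := delta_mx ord0 a.

Lemma co_bvec a c : co (bvec a) c = dl a c.
Proof. by rewrite /co mxE eqxx /dl eq_sym. Qed.

Lemma hasD_co c x v : hasD (fun y : pt R k => co y c) x v (co v c).
Proof.
have dc : differentiable (fun y : pt R k => co y c) x by exact: differentiable_coord.
split=> //.
have Did : derivable (@id (pt R k)) x v by exact: derivable_id.
by have /matrixP/(_ ord0 c) := derive_mx Did; rewrite derive_id mxE => <-.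
Qed.

Lemma gcompC x a b : gcomp F eps x a b = gcomp F eps x b a.
Proof.
rewrite !gcompE; congr (_ + _); first by ring.
by apply: eq_bigr => j _; ring.
Qed.

Lemma gcomp_v0 x d : gcomp F eps x v0 d = dl d u0.
Proof.
rewrite gcompE big1 => [|j _]; rewrite !dlE; ring.
Qed.

Lemma gcomp_vj x j d : gcomp F eps x (vj j) d = dl d (uj j).
Proof.
rewrite gcompE (single_delta (i:=j)) => [|i ij]; rewrite !dlE ?ij ?eqxx /=; ring.
Qed.

Lemma gcomp_sj x j d : gcomp F eps x (sj j) d = eps j * dl d (sj j).
Proof.
rewrite gcompE (single_delta (i:=j)) => [|i ij]; rewrite !dlE ?ij ?eqxx /=; ring.
Qed.

Hypothesis eps_pm : forall i, eps i = 1 \/ eps i = -1.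

Lemma eps_sq i : eps i * eps i = 1.
Proof. by case: (eps_pm i) => ->; ring. Qed.

Lemma gmat_sym x : (gmat F eps x)^T = gmat F eps x.
Proof. by apply/matrixP => a b; rewrite !mxE gcompC. Qed.

(** Pairing with the fields d_v and d_s, whose rows in the metric have a single entry, kills the
    components of [w] along d_u and d_s; pairing with d_u then reads off those along d_v. *)
Lemma gcomp_nondeg x (w : I -> R) :
  (forall b, \sum_c w c * gcomp F eps x c b = 0) -> forall c, w c = 0.
Proof.
move=> H.
have Hv : w u0 = 0.
  rewrite -(H v0) -[LHS](sum_dl u0 w); apply: eq_bigr => c _.
  by rewrite gcompC gcomp_v0.
have Hvj j : w (uj j) = 0.
  rewrite -(H (vj j)) -[LHS](sum_dl _ w); apply: eq_bigr => c _.
  by rewrite gcompC gcomp_vj.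
have Hsj j : w (sj j) = 0.
  rewrite -[LHS]mul1r -(eps_sq j) -mulrA -(mulr0 (eps j)) -(H (sj j)); congr (_ * _).
  rewrite -(sum_dl (sj j) w) mulr_sumr; apply: eq_bigr => c _.
  by rewrite gcompC gcomp_sj; ring.
have E b : \sum_c w c * gcomp F eps x c b = w v0 * dl b u0 + \sum_j w (vj j) * dl b (uj j).
  have -> : \sum_c w c * gcomp F eps x c b =
    \sum_c (w c * dl c u0 * dl b v0 + w c * dl c v0 * dl b u0 + \sum_j (
       w c * dl c (uj j) * dl b (vj j) + w c * dl c (vj j) * dl b (uj j)
    + eps j * dl b (sj j) * (w c * dl c (sj j))
    + 2 * F j (x ord0 (uj j)) * x ord0 (sj j) * (w c * dl c u0 * dl b (uj j) +
        w c * dl c (uj j) * dl b u0)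
    - 2 * x ord0 u0 * x ord0 (sj j) * dl b (uj j) * (w c * dl c (uj j)))).
    apply: eq_bigr => c _; rewrite gcompE mulrDr mulr_sumr; congr (_ + _); first ring.
    by apply: eq_bigr => j _; ring.
  rewrite !big_split /= exchange_big /= -!mulr_suml !sum_dl Hv mul0r add0r; congr (_ + _).
  apply: eq_bigr => j _.
  rewrite !big_split /= sumrN -!mulr_sumr !big_split /= -!mulr_suml !sum_dl Hv Hvj Hsj;
      ring.
move=> c; case: (indexP c) => [|j||j|j]; rewrite ?Hv ?Hvj ?Hsj //.
  have := H u0; rewrite E dlE big1 => [|i _]; rewrite ?dlE ?mulr0 //; lra.
have := H (uj j); rewrite E dlE (single_delta (i:=j)) => [|i ij];
    rewrite ?dlE ?eqxx ?ij /= ?mulr0 //; lra.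
Qed.

Lemma gmat_unit x : gmat F eps x \in unitmx.
Proof.
rewrite -row_free_unit; apply: inj_row_free => w /matrixP H.
apply/matrixP => i c; rewrite (ord1 i) mxE; apply: (@gcomp_nondeg x (w ord0)) => b.
by have := H ord0 b; rewrite !mxE => E; rewrite -[RHS]E; apply: eq_bigr => d _; rewrite mxE.
Qed.

Definition lowGam a b d x : R := 2^-1 * (pd a (fun y => gcomp F eps y b d) x
  + pd b (fun y => gcomp F eps y a d) x - pd d (fun y => gcomp F eps y a b) x).

Lemma Gam_low a b d x :
  \sum_c Gam F eps c a b x * gcomp F eps x c d = lowGam a b d x.
Proof.
have Hi : ginv F eps x *m gmat F eps x = 1%:M by exact/mulVmx/gmat_unit.
have Hs : (ginv F eps x)^T = ginv F eps x by rewrite /ginv trmx_inv gmat_sym.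
have Hg c e : \sum_d ginv F eps x d c * gcomp F eps x d e = (c == e)%:R.
  have /matrixP/(_ c e) := Hi; rewrite !mxE => <-.
  by apply: eq_bigr => f _; rewrite -{1}Hs !mxE.
rewrite /Gam.
under eq_bigr => c _ do rewrite -mulrA mulr_suml mulr_sumr.
rewrite exchange_big /= -[RHS](sum_delta d (fun e => lowGam a b e x)).
apply: eq_bigr => e _; rewrite eq_sym -Hg mulr_suml; apply: eq_bigr => c _.
by rewrite /lowGam; ring.
Qed.

(** Replaces the computation of [ginv]: a candidate for the Christoffel symbols is checked against
    those of the first kind, [lowGam]. *)
Lemma Gam_uniq (G : I -> R) a b x :
  (forall d, \sum_c G c * gcomp F eps x c d = lowGam a b d x) ->
  forall c, Gam F eps c a b x = G c.
Proof.
move=> H c; apply/eqP; rewrite -subr_eq0; apply/eqP.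
apply: (@gcomp_nondeg x (fun c => Gam F eps c a b x - G c)) => d.
under eq_bigr do rewrite mulrBl.
by rewrite sumrB Gam_low H subrr.
Qed.

Hypothesis smF : forall j, smoothR (F j).

(* The only nonzero components of [nabla_{d_a} d_b] are those on [d_{v_0}],
   [d_{v_j}] and [d_{s_j}]: the first is the sum over [j] of [gam_v0 x j a b],
   the second is [gam_v x j a b] and the third is [eps j * gam_s x j a b]. *)
Definition gam_v0 x j a b : R := let f := F j (co x (uj j)) in let f1 :=
    derive1 (F j) (co x (uj j)) in
  (2 * f1 + 1) * co x (sj j) * dl a (uj j) * dl b (uj j)
  + f * (dl a (uj j) * dl b (sj j) + dl a (sj j) * dl b (uj j)).
Definition gam_v x j a b : R := let f := F j (co x (uj j)) in
  - co x (sj j) * (dl a u0 * dl b (uj j) + dl a (uj j) * dl b u0)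
  + f * (dl a u0 * dl b (sj j) + dl a (sj j) * dl b u0)
  - co x u0 * (dl a (uj j) * dl b (sj j) + dl a (sj j) * dl b (uj j)).
Definition gam_s x j a b : R := let f := F j (co x (uj j)) in
  - f * (dl a u0 * dl b (uj j) + dl a (uj j) * dl b u0)
  + co x u0 * dl a (uj j) * dl b (uj j).
Definition gam_expl x c a b : R :=
  \sum_j (dl c v0 * gam_v0 x j a b + dl c (vj j) * gam_v x j a b +
      dl c (sj j) * (eps j * gam_s x j a b)).

Lemma hasD_gcomp a b x v : hasD (fun y => gcomp F eps y a b) x v
  (\sum_j (2 * (derive1 (F j) (co x (uj j)) * co v (uj j) * co x (sj j) +
      F j (co x (uj j)) * co v (sj j))
      * (dl a u0 * dl b (uj j) + dl a (uj j) * dl b u0)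
    - 2 * (co v u0 * co x (sj j) + co x u0 * co v (sj j)) * dl a (uj j) * dl b (uj j))).
Proof.
rewrite (_ : (fun y => _) = (fun y : pt R k => (dl a u0 * dl b v0 + dl a v0 * dl b u0) +
  \sum_(j < k) ((dl a (uj j) * dl b (vj j) + dl a (vj j) * dl b (uj j)
    + eps j * dl a (sj j) * dl b (sj j))
    + (2 * (dl a u0 * dl b (uj j) +
        dl a (uj j) * dl b u0)) * (F j (co y (uj j)) * co y (sj j))
    + (- 2 * dl a (uj j) * dl b (uj j)) * (co y u0 * co y (sj j))))); last first.
  apply/funext => y; rewrite gcompE; congr (_ + _).
  by apply: eq_bigr => j _; rewrite /co; ring.
eapply hasD_eq; first (eapply hasDD; first exact: hasD_cst).
  eapply hasD_sum; intro j.
  eapply hasDD; [eapply hasDD; first exact: hasD_cst|].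
    eapply hasDM; [exact: hasD_cst|eapply hasDM; [|exact: hasD_co]].
    by eapply hasD_comp1; [exact: smoothR_derivable|exact: hasD_co].
  by eapply hasDM; [exact: hasD_cst|eapply hasDM; exact: hasD_co].
rewrite add0r; apply: eq_bigr => j _ /=; ring.
Qed.

Lemma vs_contract (X Y Z : 'I_k -> R) (h : I -> R) :
  \sum_c (\sum_j (dl c v0 * X j + dl c (vj j) * Y j + dl c (sj j) * Z j)) * h c =
  \sum_j (h v0 * X j + h (vj j) * Y j + h (sj j) * Z j).
Proof.
under eq_bigr do rewrite mulr_suml.
rewrite exchange_big /=; apply: eq_bigr => j _.
have -> : \sum_c (dl c v0 * X j + dl c (vj j) * Y j + dl c (sj j) * Z j) * h c =
 \sum_c (h c * dl c v0 * X j + h c * dl c (vj j) * Y j + h c * dl c (sj j) * Z j).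
  by apply: eq_bigr => c _; ring.
by rewrite !big_split /= -!mulr_suml !sum_dl.
Qed.

Lemma GamE c a b x : Gam F eps c a b x = gam_expl x c a b.
Proof.
apply: (@Gam_uniq (fun c => gam_expl x c a b)) => d.
rewrite vs_contract /lowGam /pd !(hasD_derive (hasD_gcomp _ _ _ _)).
rewrite -big_split /= -sumrB mulr_sumr; apply: eq_bigr => j _.
rewrite gcomp_v0 gcomp_vj gcomp_sj !co_bvec /gam_v0 /gam_v /gam_s.
transitivity (dl d u0 * gam_v0 x j a b + dl d (uj j) * gam_v x j a b +
    (eps j * eps j) * dl d (sj j) * gam_s x j a b).
  by rewrite /gam_v0 /gam_v /gam_s; ring.
by rewrite eps_sq /gam_v0 /gam_v /gam_s; field.
Qed.

End Curvature.

(** * The curvature tensor in coordinates *)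

Section Tensor.
Variables (R : realType) (k : nat) (F : 'I_k -> R -> R) (eps : 'I_k -> R).
Notation I := 'I_(Mdim k).
Notation dl := (@dl R k).
Notation u0 := (u0 k). Notation v0 := (v0 k).
Implicit Types (a b c d e : I) (i j : 'I_k) (x : pt R k).
Hypothesis eps_pm : forall i, eps i = 1 \/ eps i = -1.
Hypothesis smF : forall j, smoothR (F j).

Lemma gam_expl_v0 x c a : gam_expl F eps x c a v0 = 0.
Proof. by rewrite /gam_expl big1 // => j _; rewrite /gam_v0 /gam_v /gam_s !dlE; ring. Qed.

Lemma gam_expl_vj x c a i : gam_expl F eps x c a (vj i) = 0.
Proof. by rewrite /gam_expl big1 // => j _; rewrite /gam_v0 /gam_v /gam_s !dlE; ring. Qed.

Lemma gam_expl_sj x c a i : gam_expl F eps x c a (sj i) =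
  dl c v0 * (F i (co x (uj i)) * dl a (uj i)) +
  dl c (vj i) * (F i (co x (uj i)) * dl a u0 - co x u0 * dl a (uj i)).
Proof.
rewrite /gam_expl (single_delta (i:=i)) => [|j ij];
    rewrite /gam_v0 /gam_v /gam_s !dlE ?ij ?eqxx /=; ring.
Qed.

Lemma hasD_fco (f : R -> R) c x v : smoothR f ->
  hasD (fun y : pt R k => f (co y c)) x v (derive1 f (co x c) * co v c).
Proof.
move=> sf; apply: (@hasD_comp1 _ _ f (fun y : pt R k => co y c) x v (co v c)).
  exact: smoothR_derivable.
exact: hasD_co.
Qed.

Lemma hasD_Fco j c x v :
  hasD (fun y => F j (co y c)) x v (derive1 (F j) (co x c) * co v c).
Proof. exact: (hasD_fco c x v (@smF j)). Qed.

Lemma hasD_F1co j c x v : hasD (fun y => derive1 (F j) (co y c)) x v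
  (derive1 (derive1 (F j)) (co x c) * co v c).
Proof. exact: (hasD_fco c x v (smoothR_derive1 (@smF j))). Qed.

Ltac solve_hasD := lazymatch goal with
  | |- hasD (fun _ => ?c) _ _ _ => exact: hasD_cst
  | |- hasD (fun y => co y ?c) _ _ _ => exact: hasD_co
  | |- hasD (fun y => _ + _) _ _ _ => eapply hasDD; solve_hasD
  | |- hasD (fun y => - _) _ _ _ => eapply hasDN; solve_hasD
  | |- hasD (fun y => _ * _) _ _ _ => eapply hasDM; solve_hasD
  | |- hasD (fun y => F _ (co y _)) _ _ _ => exact: hasD_Fco
  | |- hasD (fun y => derive1 (F _) (co y _)) _ _ _ => exact: hasD_F1co
  end.

Definition dgam_v0 x v j a b : R :=
  let f1 := derive1 (F j) (co x (uj j)) in let f2 :=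
      derive1 (derive1 (F j)) (co x (uj j)) in
  (2 * (f2 * co v (uj j)) * co x (sj j) + (2 * f1 +
      1) * co v (sj j)) * dl a (uj j) * dl b (uj j)
  + f1 * co v (uj j) * (dl a (uj j) * dl b (sj j) + dl a (sj j) * dl b (uj j)).
Definition dgam_v x v j a b : R := let f1 := derive1 (F j) (co x (uj j)) in
  - co v (sj j) * (dl a u0 * dl b (uj j) + dl a (uj j) * dl b u0)
  + f1 * co v (uj j) * (dl a u0 * dl b (sj j) + dl a (sj j) * dl b u0)
  - co v u0 * (dl a (uj j) * dl b (sj j) + dl a (sj j) * dl b (uj j)).
Definition dgam_s x v j a b : R := let f1 := derive1 (F j) (co x (uj j)) in
  - (f1 * co v (uj j)) * (dl a u0 * dl b (uj j) + dl a (uj j) * dl b u0)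
  + co v u0 * dl a (uj j) * dl b (uj j).

Lemma hasD_gam_v0 j a b x v : hasD (fun y => gam_v0 F y j a b) x v (dgam_v0 x v j a b).
Proof. by rewrite /gam_v0; cbv zeta; eapply hasD_eq; [solve_hasD | rewrite /dgam_v0;
    cbv beta; ring]. Qed.
Lemma hasD_gam_v j a b x v : hasD (fun y => gam_v F y j a b) x v (dgam_v x v j a b).
Proof. by rewrite /gam_v; cbv zeta; eapply hasD_eq; [solve_hasD | rewrite /dgam_v;
    cbv beta; ring]. Qed.
Lemma hasD_gam_s j a b x v : hasD (fun y => gam_s F y j a b) x v (dgam_s x v j a b).
Proof. by rewrite /gam_s; cbv zeta; eapply hasD_eq; [solve_hasD | rewrite /dgam_s;
    cbv beta; ring]. Qed.

Lemma hasD_Gam c a b x v : hasD (Gam F eps c a b) x v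
  (\sum_j (dl c v0 * dgam_v0 x v j a b + dl c (vj j) * dgam_v x v j a b
    + dl c (sj j) * (eps j * dgam_s x v j a b))).
Proof.
rewrite (_ : Gam F eps c a b = (fun y => \sum_j (dl c v0 * gam_v0 F y j a b +
    dl c (vj j) * gam_v F y j a b
    + dl c (sj j) * (eps j * gam_s F y j a b)))); last by apply/funext => y; rewrite GamE.
apply: hasD_sum => j.
eapply hasD_eq.
  eapply hasDD; [eapply hasDD|]; (eapply hasDM; first exact: hasD_cst).
  - exact: hasD_gam_v0.
  - exact: hasD_gam_v.
  - eapply hasDM; [exact: hasD_cst|exact: hasD_gam_s].
cbv beta; ring.
Qed.

(* The 2-forms du_0 /\ du_j and du_j /\ ds_j. *)
Definition omega j a b : R := dl a u0 * dl b (uj j) - dl a (uj j) * dl b u0.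
Definition sigma j a b : R := dl a (uj j) * dl b (sj j) - dl a (sj j) * dl b (uj j).

Lemma RcoefE f a b c x : Rcoef F eps f a b c x =
  \sum_j (dl f v0 * (dgam_v0 x (bvec R a) j b c - dgam_v0 x (bvec R b) j a c
            + eps j * (gam_s F x j b c * (F j (co x (uj j)) * dl a (uj j))
                     - gam_s F x j a c * (F j (co x (uj j)) * dl b (uj j))))
        + dl f (vj j) * (dgam_v x (bvec R a) j b c - dgam_v x (bvec R b) j a c
            + eps j * (gam_s F x j b c * (F j (co x (uj j)) * dl a u0 -
                co x u0 * dl a (uj j))
                     - gam_s F x j a c * (F j (co x (uj j)) * dl b u0 -
                         co x u0 * dl b (uj j))))
        + dl f (sj j) * (eps j * (dgam_s x (bvec R a) j b c - dgam_s x (bvec R b) j a c))).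
Proof.
rewrite /Rcoef /pd !(hasD_derive (hasD_Gam _ _ _ _ _)).
(* The intermediate index [e] runs over d_v and d_s only. The d_v are parallel, so the product of
   Christoffel symbols survives for [e = sj j] alone. *)
have H a' b' : \sum_e Gam F eps e b' c x * Gam F eps f a' e x =
  \sum_j (dl f v0 * (eps j * (gam_s F x j b' c * (F j (co x (uj j)) * dl a' (uj j))))
    + dl f (vj j) * (eps j * (gam_s F x j b' c * (F j (co x (uj j)) * dl a' u0 -
        co x u0 * dl a' (uj j))))).
  under eq_bigr do rewrite !GamE //.
  rewrite vs_contract; apply: eq_bigr => j _.
  by rewrite gam_expl_v0 gam_expl_vj gam_expl_sj; ring.
rewrite sumrB !H -!sumrB -big_split /=; apply: eq_bigr => j _; ring.
Qed.

(** In [f_j' + 1] both terms come from differentiating [gam_s]: the 1 from its factor u_0 along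
    d_{u_0}, the f_j' from its factor f_j along d_{u_j}. The term in f_j^2 is the product of
    Christoffel symbols. *)
Lemma RcompE x a b c d : Rcomp F eps x a b c d =
  \sum_j ((derive1 (F j) (co x (uj j)) + 1) * (omega j a b * sigma j c d +
      sigma j a b * omega j c d)
    - eps j * (F j (co x (uj j)) * F j (co x (uj j))) * omega j a b * omega j c d).
Proof.
rewrite /Rcomp; under eq_bigr do rewrite RcoefE.
rewrite vs_contract; apply: eq_bigr => j _.
rewrite gcomp_v0 gcomp_vj gcomp_sj mulrACA eps_sq //.
rewrite /dgam_v0 /dgam_v /dgam_s /gam_s !co_bvec /omega /sigma; ring.
Qed.

End Tensor.

(** * Covariant derivatives of the curvature *)

Section Lists.
Variables (R : realType) (k : nat) (F : 'I_k -> R -> R) (eps : 'I_k -> R).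
Notation I := 'I_(Mdim k).
Implicit Types (a b c d : I) (x : pt R k) (l : seq I).

(** The correction sum of [covd], recast as a recursion on the list of slots so that it can be
    treated by induction. *)
Fixpoint corr (N : I -> I -> R) l (t : seq I -> R) : R :=
  if l is a :: l' then \sum_c N a c * t (c :: l') + corr N l' (fun l => t (a :: l))
  else 0.

Lemma corrE N l t z :
  \sum_(r < size l) \sum_c N (nth z l r) c * t (set_nth z l r c) = corr N l t.
Proof.
elim: l t => [|a l IH] t /=; first by rewrite big_ord0.
by rewrite big_ord_recl /= -IH.
Qed.

Lemma covd_rcons T x l b : covd F eps T x (rcons l b) =
  pd b (fun y => T y l) x - corr (fun a c => Gam F eps c b a x) l (T x).
Proof. by rewrite /covd rev_rcons revK -(corrE _ _ _ (iU ord0)). Qed.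

End Lists.

Section Nabla.
Variables (R : realType) (k : nat) (F : 'I_k -> R -> R) (eps : 'I_k -> R).
Notation I := 'I_(Mdim k).
Notation dl := (@dl R k).
Notation u0 := (u0 k). Notation v0 := (v0 k).
Notation omega := (@omega R k). Notation sigma := (@sigma R k).
Implicit Types (a b c d e : I) (i j : 'I_k) (x : pt R k).
Hypothesis eps_pm : forall i, eps i = 1 \/ eps i = -1.
Hypothesis smF : forall j, smoothR (F j).

(* [coefA m j] and [- coefB m j] are the coefficients of
   omega_j.sigma_j + sigma_j.omega_j and omega_j.omega_j in nabla^m R, in the
   direction of m copies of d_{u_j}.  As nabla_b sigma_j = - eps_j f_j du_j(b) omega_j
   and nabla omega_j = 0, each derivative feeds 2 eps_j f_j [coefA] into [coefB]. *)
Definition coefA m j : R -> R := derive1n m (fun u => derive1 (F j) u + 1).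
Fixpoint coefB m j : R -> R :=
  if m is m'.+1 then fun u => derive1 (coefB m' j) u + 2 * eps j * (F j u * coefA m' j u)
  else fun u => eps j * (F j u * F j u).

Lemma smooth_coefA m j : smoothR (coefA m j).
Proof.
have s0 : smoothR (fun u => derive1 (F j) u + 1).
  by apply: smoothRD; [exact/smoothR_derive1/smF|exact: smoothR_cst].
elim: m => [|m IH]; first exact: s0.
by rewrite /coefA derive1nS; exact: smoothR_derive1.
Qed.

Lemma smooth_coefB m j : smoothR (coefB m j).
Proof.
elim: m => [|m IH] /=.
  apply: smoothRM; first exact: smoothR_cst.
  by apply: smoothRM; exact: smF.
apply: smoothRD; first exact: smoothR_derive1.
apply: smoothRM; first exact: smoothR_cst.
by apply: smoothRM; [exact: smF|exact: smooth_coefA].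
Qed.

Definition prodl j (l : seq I) : R := \prod_(y <- l) dl y (uj j).

Definition nabT m x a b c d (ys : seq I) : R :=
  \sum_j prodl j ys * (coefA m j (co x (uj j)) * (omega j a b * sigma j c d +
      sigma j a b * omega j c d)
    - coefB m j (co x (uj j)) * (omega j a b * omega j c d)).

Lemma hasD_nabT m a b c d ys x v : hasD (fun y => nabT m y a b c d ys) x v
  (\sum_j prodl j ys * (derive1 (coefA m j) (co x (uj j)) * co v (uj j) * (omega j a b *
      sigma j c d + sigma j a b * omega j c d)
    - derive1 (coefB m j) (co x (uj j)) * co v (uj j) * (omega j a b * omega j c d))).
Proof.
apply: hasD_sum => j.
eapply hasD_eq.
  eapply hasDM; first exact: hasD_cst.
  eapply hasDD; last eapply hasDN; (eapply hasDM; last exact: hasD_cst).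
  - exact: (hasD_fco _ _ _ (@smooth_coefA m j)).
  - exact: (hasD_fco _ _ _ (@smooth_coefB m j)).
cbv beta; ring.
Qed.

(** The derivative slots contain only the covectors du_j, and these are parallel because no
    Christoffel symbol has a component along d_{u_j}. *)
Lemma corr_tail (N : I -> I -> R) l t (K : 'I_k -> R) :
  (forall l', size l' = size l -> t l' = \sum_j prodl j l' * K j) ->
  (forall a j, \sum_c N a c * dl c (uj j) = 0) -> corr N l t = 0.
Proof.
move=> Ht HN; elim: l t K Ht => [//|a l IH] t K Ht /=.
rewrite (IH (fun l => t (a :: l)) (fun j => dl a (uj j) * K j)); last first.
  move=> l' sl'; rewrite Ht /=; last by rewrite sl'.
  by apply: eq_bigr => j _; rewrite /prodl big_cons; ring.
rewrite addr0.
have -> : \sum_c N a c * t (c :: l) = \sum_c \sum_j N a c * dl c (uj j) * (prodl j l * K j).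
  apply: eq_bigr => c _; rewrite Ht // mulr_sumr; apply: eq_bigr => j _.
  by rewrite /prodl big_cons; ring.
rewrite exchange_big big1 // => j _.
by rewrite -mulr_suml HN mul0r.
Qed.

Definition tau j y a x : R := eps j * gam_s F x j y a.

Lemma Gam_sj j y a x : Gam F eps (sj j) y a x = tau j y a x.
Proof.
rewrite GamE // /gam_expl (single_delta (i:=j)) => [|i ij]; rewrite !dlE ?ij ?eqxx /=
    /tau; ring.
Qed.

Lemma Gam_uj j y a x : Gam F eps (uj j) y a x = 0.
Proof. by rewrite GamE // /gam_expl big1 // => i _; rewrite !dlE; ring. Qed.

Lemma Gam_u0 y a x : Gam F eps u0 y a x = 0.
Proof. by rewrite GamE // /gam_expl big1 // => i _; rewrite !dlE; ring. Qed.

(** Among du_0, du_j and ds_j only ds_j fails to be parallel, so a curvature slot contributes its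
    ds_j-coefficient times [tau]. *)
Lemma Gam_slot y a x (t : I -> R) (al be ga : 'I_k -> R) :
  (forall c, t c = \sum_j (al j * dl c u0 + be j * dl c (uj j) + ga j * dl c (sj j))) ->
  \sum_c Gam F eps c y a x * t c = \sum_j ga j * tau j y a x.
Proof.
move=> Ht.
have -> : \sum_c Gam F eps c y a x * t c = \sum_c \sum_j
   (Gam F eps c y a x * dl c u0 * al j + Gam F eps c y a x * dl c (uj j) * be j
     + Gam F eps c y a x * dl c (sj j) * ga j).
  by apply: eq_bigr => c _; rewrite Ht mulr_sumr; apply: eq_bigr => j _; ring.
rewrite exchange_big; apply: eq_bigr => j _.
rewrite !big_split /= -!mulr_suml !sum_dl Gam_uj Gam_u0 Gam_sj; ring.
Qed.

Lemma nablaRE m x a b c d ys : size ys = m ->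
  nablaR F eps m x [:: a, b, c, d & ys] = nabT m x a b c d ys.
Proof.
elim: m x a b c d ys => [|m IH] x a b c d ys.
  move/size0nil => ->; rewrite /= RcompE //; apply: eq_bigr => j _.
  by rewrite /prodl big_nil /coefA /=; ring.
case/lastP: ys => [//|ys y]; rewrite size_rcons => -[sys].
rewrite -!rcons_cons /nablaR iterS -/(nablaR F eps m) covd_rcons.
rewrite (_ : (fun z => _) = (fun z => nabT m z a b c d ys)); last first.
  by apply/funext => z; rewrite IH.
rewrite /pd (hasD_derive (hasD_nabT _ _ _ _ _ _ _ _)) /=.
rewrite (@corr_tail _ ys _ (fun j =>
    coefA m j (co x (uj j)) * (omega j a b * sigma j c d + sigma j a b * omega j c d)
    - coefB m j (co x (uj j)) * (omega j a b * omega j c d))); first last.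
- by move=> e j; rewrite sum_dl Gam_uj.
- by move=> l sl; rewrite IH ?sl.
pose A j := coefA m j (co x (uj j)); pose B j := coefB m j (co x (uj j)).
(* The three families are the coefficients of du_0, du_j and ds_j of [nabT] in the first slot, the
   others being held fixed. The next three rewrites do the same for the other curvature slots, with
   the signs given by antisymmetry. *)
rewrite (@Gam_slot y a x _
  (fun j => prodl j ys * dl b (uj j) * (A j * sigma j c d - B j * omega j c d))
  (fun j => prodl j ys * (A j * (- dl b u0 * sigma j c d + dl b (sj j) * omega j c d) +
      B j * dl b u0 * omega j c d))
  (fun j => - prodl j ys * A j * dl b (uj j) * omega j c d)); last first.
  move=> e; rewrite IH //; apply: eq_bigr => j _;
      rewrite /nabT -/(A j) -/(B j) /omega /sigma; ring.
rewrite (@Gam_slot y b x _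
  (fun j => - prodl j ys * dl a (uj j) * (A j * sigma j c d - B j * omega j c d))
  (fun j => - prodl j ys * (A j * (- dl a u0 * sigma j c d + dl a (sj j) * omega j c d) +
      B j * dl a u0 * omega j c d))
  (fun j => prodl j ys * A j * dl a (uj j) * omega j c d)); last first.
  move=> e; rewrite IH //; apply: eq_bigr => j _;
      rewrite /nabT -/(A j) -/(B j) /omega /sigma; ring.
rewrite (@Gam_slot y c x _
  (fun j => prodl j ys * dl d (uj j) * (A j * sigma j a b - B j * omega j a b))
  (fun j => prodl j ys * (A j * (- dl d u0 * sigma j a b + dl d (sj j) * omega j a b) +
      B j * dl d u0 * omega j a b))
  (fun j => - prodl j ys * A j * dl d (uj j) * omega j a b)); last first.
  move=> e; rewrite IH //; apply: eq_bigr => j _;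
      rewrite /nabT -/(A j) -/(B j) /omega /sigma; ring.
rewrite (@Gam_slot y d x _
  (fun j => - prodl j ys * dl c (uj j) * (A j * sigma j a b - B j * omega j a b))
  (fun j => - prodl j ys * (A j * (- dl c u0 * sigma j a b + dl c (sj j) * omega j a b) +
      B j * dl c u0 * omega j a b))
  (fun j => prodl j ys * A j * dl c (uj j) * omega j a b)); last first.
  move=> e; rewrite IH //; apply: eq_bigr => j _;
      rewrite /nabT -/(A j) -/(B j) /omega /sigma; ring.
rewrite addr0 -!big_split /= -sumrB; apply: eq_bigr => j _.
have -> : prodl j (rcons ys y) = prodl j ys * dl y (uj j).
  by rewrite /prodl -cats1 big_cat big_seq1.
rewrite co_bvec /tau /gam_s /= -/(A j) -/(B j).
rewrite /omega /sigma; ring.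
Qed.

Lemma differentiable_nablaR m a b c d ys x : size ys = m ->
  differentiable (fun y => nablaR F eps m y [:: a, b, c, d & ys]) x.
Proof.
move=> sys; rewrite (_ : (fun y => _) = (fun y => nabT m y a b c d ys)).
  by have [] := hasD_nabT m a b c d ys x 0.
by apply/funext => y; rewrite nablaRE.
Qed.

End Nabla.

(** * Evaluation of component fields on vectors *)

Section Teval.
Variables (R : realType) (k : nat).
Notation I := 'I_(Mdim k).
Implicit Types (X : pt R k) (Xs : seq (pt R k)) (t : seq I -> R).

Lemma teval_ext Xs t t' : (forall l, size l = size Xs -> t l = t' l) ->
  teval Xs t = teval Xs t'.
Proof.
elim: Xs t t' => [|X Xs IH] t t' H /=; first exact: H.
apply: eq_bigr => a _; congr (_ * _); apply: IH => l sl.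
by apply: H; rewrite /= sl.
Qed.

Lemma teval_sum n (t : 'I_n -> seq I -> R) Xs :
  teval Xs (fun l => \sum_i t i l) = \sum_i teval Xs (t i).
Proof.
elim: Xs t => [//|X Xs IH] t /=.
under eq_bigr do rewrite IH mulr_sumr.
by rewrite exchange_big.
Qed.

Lemma tevalZ (c : R) t Xs : teval Xs (fun l => c * t l) = c * teval Xs t.
Proof.
elim: Xs t => [//|X Xs IH] t /=.
rewrite mulr_sumr; apply: eq_bigr => a _; rewrite IH; ring.
Qed.

Lemma tevalD t t' Xs : teval Xs (fun l => t l + t' l) = teval Xs t + teval Xs t'.
Proof.
elim: Xs t t' => [//|X Xs IH] t t' /=.
by rewrite -big_split; apply: eq_bigr => a _; rewrite IH /= mulrDr.
Qed.

Lemma teval_bvec (l : seq I) t : teval (map (@bvec R k) l) t = t l.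
Proof.
elim: l t => [//|a l IH] t /=.
rewrite -[RHS](sum_delta a (fun c => t (c :: l))); apply: eq_bigr => c _.
by rewrite IH -/(co _ _) co_bvec.
Qed.

Lemma teval_prodl (j : 'I_k) Xs (K : R) :
  teval Xs (fun l => prodl R j l * K) = (\prod_(X <- Xs) co X (uj j)) * K.
Proof.
elim: Xs K => [|X Xs IH] K /=; first by rewrite /prodl !big_nil.
rewrite big_cons -mulrA -IH -(sum_dl (uj j) (co X)) mulr_suml.
apply: eq_bigr => a _; rewrite -mulrA; congr (_ * _).
rewrite -tevalZ; apply: teval_ext => l _; rewrite /prodl big_cons; ring.
Qed.

End Teval.

(** * Normalized bases *)

Section Eval.
Variables (R : realType) (k : nat) (F : 'I_k -> R -> R) (eps : 'I_k -> R).
Notation I := 'I_(Mdim k).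
Notation dl := (@dl R k).
Notation u0 := (u0 k). Notation v0 := (v0 k).
Notation ev := (@bvec R k).
Implicit Types (a b c d : I) (i j : 'I_k) (x X Y Z W : pt R k).
Hypothesis eps_pm : forall i, eps i = 1 \/ eps i = -1.
Hypothesis smF : forall j, smoothR (F j).

Definition omegaV j X Y : R := co X u0 * co Y (uj j) - co X (uj j) * co Y u0.
Definition sigmaV j X Y : R := co X (uj j) * co Y (sj j) - co X (sj j) * co Y (uj j).
Definition quad m x j X Y Z W : R :=
  coefA F m j (co x (uj j)) * (omegaV j X Y * sigmaV j Z W + sigmaV j X Y * omegaV j Z W)
  - coefB F eps m j (co x (uj j)) * (omegaV j X Y * omegaV j Z W).

Lemma sum_lin3 X j (al be ga : R) :
  \sum_a co X a * (al * dl a u0 + be * dl a (uj j) + ga * dl a (sj j)) =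
  al * co X u0 + be * co X (uj j) + ga * co X (sj j).
Proof.
under eq_bigr do rewrite !mulrDr !(mulrCA (co X _)).
by rewrite !big_split /= -!mulr_sumr !sum_dl.
Qed.

(** Each slot sees a vector only through its components along u_0, u_j and s_j; the explicit factors
    in the proof are the coefficients of these three. *)
Lemma quad_lin m x j X Y Z W : [/\
  \sum_a co X a * quad m x j (ev a) Y Z W = quad m x j X Y Z W,
  \sum_a co Y a * quad m x j X (ev a) Z W = quad m x j X Y Z W,
  \sum_a co Z a * quad m x j X Y (ev a) W = quad m x j X Y Z W &
  \sum_a co W a * quad m x j X Y Z (ev a) = quad m x j X Y Z W].
Proof.
pose A := coefA F m j (co x (uj j)); pose B := coefB F eps m j (co x (uj j)).
split.
- transitivity (\sum_a co X a * (
    (A * co Y (uj j) * sigmaV j Z W - B * co Y (uj j) * omegaV j Z W) * dl a u0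
    + (A * (- co Y u0 * sigmaV j Z W + co Y (sj j) * omegaV j Z W) +
        B * co Y u0 * omegaV j Z W) * dl a (uj j)
    + (- A * co Y (uj j) * omegaV j Z W) * dl a (sj j))); last first.
    by rewrite sum_lin3 /quad -/A -/B /omegaV /sigmaV; ring.
  by apply: eq_bigr => a _; rewrite /quad -/A -/B /omegaV /sigmaV !co_bvec; ring.
- transitivity (\sum_a co Y a * (
    (- A * co X (uj j) * sigmaV j Z W + B * co X (uj j) * omegaV j Z W) * dl a u0
    + (A * (co X u0 * sigmaV j Z W - co X (sj j) * omegaV j Z W) -
        B * co X u0 * omegaV j Z W) * dl a (uj j)
    + (A * co X (uj j) * omegaV j Z W) * dl a (sj j))); last first.
    by rewrite sum_lin3 /quad -/A -/B /omegaV /sigmaV; ring.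
  by apply: eq_bigr => a _; rewrite /quad -/A -/B /omegaV /sigmaV !co_bvec; ring.
- transitivity (\sum_a co Z a * (
    (A * co W (uj j) * sigmaV j X Y - B * co W (uj j) * omegaV j X Y) * dl a u0
    + (A * (- co W u0 * sigmaV j X Y + co W (sj j) * omegaV j X Y) +
        B * co W u0 * omegaV j X Y) * dl a (uj j)
    + (- A * co W (uj j) * omegaV j X Y) * dl a (sj j))); last first.
    by rewrite sum_lin3 /quad -/A -/B /omegaV /sigmaV; ring.
  by apply: eq_bigr => a _; rewrite /quad -/A -/B /omegaV /sigmaV !co_bvec; ring.
- transitivity (\sum_a co W a * (
    (- A * co Z (uj j) * sigmaV j X Y + B * co Z (uj j) * omegaV j X Y) * dl a u0
    + (A * (co Z u0 * sigmaV j X Y - co Z (sj j) * omegaV j X Y) -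
        B * co Z u0 * omegaV j X Y) * dl a (uj j)
    + (A * co Z (uj j) * omegaV j X Y) * dl a (sj j))); last first.
    by rewrite sum_lin3 /quad -/A -/B /omegaV /sigmaV; ring.
  by apply: eq_bigr => a _; rewrite /quad -/A -/B /omegaV /sigmaV !co_bvec; ring.
Qed.

Lemma teval_nablaR m x X Y Z W Ys : size Ys = m ->
  teval [:: X, Y, Z, W & Ys] (nablaR F eps m x) =
  \sum_j (\prod_(V <- Ys) co V (uj j)) * quad m x j X Y Z W.
Proof.
move=> sYs /=.
have E a b c d : teval Ys (fun l => nablaR F eps m x [:: a, b, c, d & l]) =
    \sum_j (\prod_(V <- Ys) co V (uj j)) * quad m x j (ev a) (ev b) (ev c) (ev d).
  rewrite (@teval_ext _ _ _ _ (fun l =>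
      \sum_j prodl R j l * quad m x j (ev a) (ev b) (ev c) (ev d))).
    by rewrite teval_sum; apply: eq_bigr => j _; rewrite teval_prodl.
  move=> l sl; rewrite nablaRE //; last by rewrite sl.
  apply: eq_bigr => j _; congr (_ * _).
  by rewrite /quad /omegaV /sigmaV !co_bvec.
have sw (V : pt R k) (q : 'I_k -> I -> R) (p r : 'I_k -> R) :
    (forall j, \sum_a co V a * q j a = r j) ->
    \sum_a V ord0 a * (\sum_j p j * q j a) = \sum_j p j * r j.
  move=> H; under eq_bigr do rewrite mulr_sumr.
  rewrite exchange_big; apply: eq_bigr => j _; rewrite -H mulr_sumr.
  by apply: eq_bigr => a _; rewrite mulrCA.
pose p j := \prod_(V <- Ys) co V (uj j).
transitivity (\sum_a X ord0 a * (\sum_j p j * quad m x j (ev a) Y Z W)); last first.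
  by apply: sw => j; have [] := quad_lin m x j X Y Z W.
apply: eq_bigr => a _; congr (_ * _).
transitivity (\sum_b Y ord0 b * (\sum_j p j * quad m x j (ev a) (ev b) Z W)); last first.
  by apply: sw => j; have [] := quad_lin m x j (ev a) Y Z W.
apply: eq_bigr => b _; congr (_ * _).
transitivity (\sum_c Z ord0 c * (\sum_j p j * quad m x j (ev a) (ev b) (ev c) W));
    last first.
  by apply: sw => j; have [] := quad_lin m x j (ev a) (ev b) Z W.
apply: eq_bigr => c _; congr (_ * _).
transitivity (\sum_d W ord0 d * (\sum_j p j * quad m x j (ev a) (ev b) (ev c) (ev d)));
    last first.
  by apply: sw => j; have [] := quad_lin m x j (ev a) (ev b) (ev c) W.
by apply: eq_bigr => d _; congr (_ * _).
Qed.

Lemma sum_lin_full X (p q : R) (al be ga de : 'I_k -> R) :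
  \sum_a co X a * (p * dl a u0 + q * dl a v0 + \sum_j
     (al j * dl a u0 + be j * dl a (uj j) + ga j * dl a (vj j) + de j * dl a (sj j))) =
  p * co X u0 + q * co X v0 + \sum_j
     (al j * co X u0 + be j * co X (uj j) + ga j * co X (vj j) + de j * co X (sj j)).
Proof.
under eq_bigr do rewrite !mulrDr !(mulrCA (co X _)).
rewrite !big_split /= -!mulr_sumr !sum_dl; congr (_ + _).
rewrite -!big_split; under eq_bigr do rewrite mulr_sumr.
rewrite exchange_big /=; apply: eq_bigr => j _.
under eq_bigr do rewrite !mulrDr !(mulrCA (co X _)).
by rewrite !big_split /= -!mulr_sumr !sum_dl.
Qed.

Lemma gPE x X Y : gP F eps x X Y =
  co X u0 * co Y v0 + co X v0 * co Y u0 +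
  \sum_j (co X (uj j) * co Y (vj j) + co X (vj j) * co Y (uj j)
    + eps j * co X (sj j) * co Y (sj j)
    + 2 * F j (co x (uj j)) * co x (sj j) * (co X u0 * co Y (uj j) + co X (uj j) * co Y u0)
    - 2 * co x u0 * co x (sj j) * co X (uj j) * co Y (uj j)).
Proof.
transitivity (\sum_a co X a * (co Y v0 * dl a u0 + co Y u0 * dl a v0 + \sum_j
   (2 * F j (co x (uj j)) * co x (sj j) * co Y (uj j) * dl a u0
   + (co Y (vj j) + 2 * F j (co x (uj j)) * co x (sj j) * co Y u0
       - 2 * co x u0 * co x (sj j) * co Y (uj j)) * dl a (uj j)
   + co Y (uj j) * dl a (vj j) + eps j * co Y (sj j) * dl a (sj j)))); last first.
  rewrite sum_lin_full; congr (_ + _); first by ring.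
  by apply: eq_bigr => j _; ring.
apply: eq_bigr => a _.
transitivity (co X a * (\sum_b co Y b * (dl a v0 * dl b u0 + dl a u0 * dl b v0 + \sum_j
   (2 * F j (co x (uj j)) * co x (sj j) * dl a (uj j) * dl b u0
   + (dl a (vj j) + 2 * F j (co x (uj j)) * co x (sj j) * dl a u0
       - 2 * co x u0 * co x (sj j) * dl a (uj j)) * dl b (uj j)
   + dl a (uj j) * dl b (vj j) + eps j * dl a (sj j) * dl b (sj j))))); last first.
  congr (_ * _); rewrite sum_lin_full; congr (_ + _); first by ring.
  by apply: eq_bigr => j _; ring.
rewrite mulr_sumr; apply: eq_bigr => b _; rewrite -/(co X a) -/(co Y b) gcompE.
rewrite -mulrA; congr (_ * _); rewrite mulrC; congr (_ * _); congr (_ + _); first by ring.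
by apply: eq_bigr => j _; rewrite /co; ring.
Qed.

End Eval.

Section LinearExt.
Variables (R : realType) (k : nat) (B : 'I_(Mdim k) -> pt R k).
Hypothesis freeB : row_free (\matrix_(a < Mdim k) (B a : 'rV[R]_(Mdim k))).

Definition lin (f : pt R k -> R) := exists phi : 'I_(Mdim k) -> R,
  forall X, f X = \sum_a co X a * phi a.

Lemma linB f g : lin f -> lin g -> lin (fun X => f X - g X).
Proof.
move=> [p Hp] [q Hq]; exists (fun a => p a - q a) => X.
by rewrite Hp Hq -sumrB; apply: eq_bigr => a _; rewrite mulrBr.
Qed.

Lemma linZ (c : R) f : lin f -> lin (fun X => c * f X).
Proof.
move=> [p Hp]; exists (fun a => c * p a) => X.
by rewrite Hp mulr_sumr; apply: eq_bigr => a _; rewrite mulrCA.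
Qed.

Lemma lin_eq f g : lin f -> (forall X, g X = f X) -> lin g.
Proof. by move=> [p Hp] E; exists p => X; rewrite E. Qed.

Lemma lin_ext f : lin f -> (forall a, f (B a) = 0) -> forall X, f X = 0.
Proof.
move=> [p Hp] HB.
have Bu : \matrix_(a < Mdim k) (B a : 'rV[R]_(Mdim k)) \in unitmx by rewrite -row_free_unit.
have H : \matrix_(a < Mdim k) (B a : 'rV[R]_(Mdim k)) *m (\col_a p a) = 0.
  apply/matrixP => a i; rewrite !mxE -[RHS](HB a) Hp; apply: eq_bigr => b _.
  by rewrite !mxE.
have p0 a : p a = 0.
  have : \col_a p a = 0 :> 'cV[R]_(Mdim k) by rewrite -(mulKmx Bu (\col_a p a)) H mulmx0.
  by move/matrixP/(_ a ord0); rewrite !mxE.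
by move=> X; rewrite Hp big1 // => a _; rewrite p0 mulr0.
Qed.

End LinearExt.

Section Normalized.
Variables (R : realType) (k : nat) (F : 'I_k -> R -> R) (eps : 'I_k -> R).
Notation I := 'I_(Mdim k).
Notation dl := (@dl R k).
Notation u0 := (u0 k). Notation v0 := (v0 k).
Notation ev := (@bvec R k).
Notation omegaV := (@omegaV R k). Notation sigmaV := (@sigmaV R k).
Implicit Types (a b c d : I) (i j l : 'I_k) (X Y Z W : pt R k).
Hypothesis eps_pm : forall i, eps i = 1 \/ eps i = -1.
Hypothesis smF : forall j, smoothR (F j).
Hypothesis F1 : forall j u, derive1n 1 (F j) u + 1 != 0.
Variables (P : pt R k) (B : I -> pt R k).
Hypothesis nB : normalized F eps P B.

Let q j : R := derive1 (F j) (co P (uj j)) + 1.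
Let ff j : R := eps j * (F j (co P (uj j)) * F j (co P (uj j))).
Let RR X Y Z W := teval [:: X; Y; Z; W] (nablaR F eps 0 P).
Let g := gP F eps P.

Let q_neq0 j : q j != 0. Proof. exact: F1. Qed.

Let RRE X Y Z W : RR X Y Z W = \sum_j (q j * (omegaV j X Y * sigmaV j Z W +
    sigmaV j X Y * omegaV j Z W)
   - ff j * (omegaV j X Y * omegaV j Z W)).
Proof.
rewrite /RR (@teval_nablaR _ _ _ _ eps_pm smF 0 P X Y Z W [::] erefl).
by apply: eq_bigr => j _; rewrite big_nil mul1r.
Qed.

Let RR_anti X Y Z W : RR X Y Z W = - RR Y X Z W.
Proof.
by rewrite !RRE -sumrN; apply: eq_bigr => j _; rewrite /omegaV /sigmaV; ring.
Qed.

Let RR_pair X Y Z W : RR X Y Z W = RR Z W X Y.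
Proof. by rewrite !RRE; apply: eq_bigr => j _; rewrite /omegaV /sigmaV; ring. Qed.

Let RR_lin Y Z W : lin (fun X => RR X Y Z W).
Proof. by eexists => X; rewrite /RR /=; reflexivity. Qed.

Let g_lin Y : lin (fun X => g X Y).
Proof.
exists (fun a => \sum_b gcomp F eps P a b * Y ord0 b) => X.
by apply: eq_bigr => a _; rewrite mulr_sumr; apply: eq_bigr => b _; rewrite mulrA.
Qed.

Let freeB : row_free (\matrix_(a < Mdim k) (B a : 'rV[R]_(Mdim k))).
Proof. by case: nB. Qed.
Let gB a b : g (B a) (B b) = gmodel eps a b.
Proof. by case: nB => _ H _; exact: H. Qed.
Let RB a b c d : RR (B a) (B b) (B c) (B d) = rmodel R a b c d.
Proof. by case: nB => _ _ H; exact: H. Qed.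

Let RV (i : 'I_k.+1) b c d : rmodel R (iV i) b c d = 0.
Proof. by rewrite /rmodel lab_iV. Qed.

(** No entry of the model carries a V-label, so the V's lie in the kernel of [R]. The three facts
    after this one test that kernel on coordinate fields: each isolates [q j] times one component,
    and [q j] is nonzero. *)
Let RR_V (i : 'I_k.+1) X Y Z : RR (B (iV i)) X Y Z = 0.
Proof.
have H1 a b Z' : RR (B (iV i)) (B a) (B b) Z' = 0.
  rewrite RR_pair RR_anti; apply/eqP; rewrite oppr_eq0; apply/eqP.
  apply: (lin_ext freeB (RR_lin _ _ _)) => c.
  by rewrite RR_anti -RR_pair RB RV oppr0.
have H2 a Y' Z' : RR (B (iV i)) (B a) Y' Z' = 0.
  rewrite RR_pair; apply: (lin_ext freeB (RR_lin _ _ _)) => b.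
  by rewrite -RR_pair.
rewrite RR_anti; apply/eqP; rewrite oppr_eq0; apply/eqP.
by apply: (lin_ext freeB (RR_lin _ _ _)) => a; rewrite RR_anti H2 oppr0.
Qed.

Let V_u0 (i : 'I_k.+1) j : co (B (iV i)) u0 = 0.
Proof.
have := RR_V i (ev (uj j)) (ev (uj j)) (ev (sj j)).
rewrite RRE (single_delta (i:=j)) => [|l jl];
    rewrite /omegaV /sigmaV !co_bvec !dlE ?jl ?eqxx /=; last by ring.
move=> H; apply/eqP; rewrite -(mulrI_eq0 _ (mulfI (q_neq0 j))); apply/eqP.
by rewrite -[RHS]H; ring.
Qed.

Let V_uj (i : 'I_k.+1) j : co (B (iV i)) (uj j) = 0.
Proof.
have := RR_V i (ev u0) (ev (uj j)) (ev (sj j)).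
rewrite RRE (single_delta (i:=j)) => [|l jl];
    rewrite /omegaV /sigmaV !co_bvec !dlE ?jl ?eqxx /=; last by ring.
move=> H; apply/eqP; rewrite -oppr_eq0 -(mulrI_eq0 _ (mulfI (q_neq0 j))); apply/eqP.
by rewrite -[RHS]H; ring.
Qed.

Let V_sj (i : 'I_k.+1) j : co (B (iV i)) (sj j) = 0.
Proof.
have := RR_V i (ev (uj j)) (ev (uj j)) (ev u0).
rewrite RRE (single_delta (i:=j)) => [|l jl];
    rewrite /omegaV /sigmaV !co_bvec !dlE ?jl ?eqxx /=; last by ring.
rewrite (V_u0 i j) => H; apply/eqP; rewrite -(mulrI_eq0 _ (mulfI (q_neq0 j))); apply/eqP.
by rewrite -[RHS]H; ring.
Qed.

(** The covector dual to [U_i] in the basis [B] (see [ufB]). As [V_i] lies in the span of the d_v,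
    it is a combination of the du alone (see [ufE], whose index [j] names a coordinate on which
    [V_u0] is tested). *)
Let uf (i : 'I_k.+1) X := g X (B (iV i)).

Let ufE j (i : 'I_k.+1) X : uf i X = co X u0 * co (B (iV i)) v0 +
    \sum_l co X (uj l) * co (B (iV i)) (vj l).
Proof.
rewrite /uf /g gPE (V_u0 i j) mulr0 addr0; congr (_ + _).
by apply: eq_bigr => l _; rewrite V_uj V_sj; ring.
Qed.

Let ufB (i : 'I_k.+1) a : uf i (B a) = dl a (iU i).
Proof.
rewrite /uf gB /gmodel lab_iV.
case: (indexP a) => [|j||j|j]; rewrite ?(lab_iU, lab_iV, lab_iS) /dl;
  rewrite ?(inj_eq (@iU_inj k)); try (by case: eqP); 
  by rewrite -/(dl _ _) dlE.
Qed.

Let RS a b c j : rmodel R a b c (sj j) =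
  (dl a u0 * dl b (uj j) - dl a (uj j) * dl b u0) * dl c (uj j).
Proof.
case: (indexP a) => [|a'||a'|a']; case: (indexP b) => [|b'||b'|b'];
case: (indexP c) => [|c'||c'|c']; rewrite /rmodel ?(lab_iU, lab_iV, lab_iS) !dlE;
try ring; rewrite ?eqxx ?(inj_eq lift_inj) ?eq_liftF ?lift_eqF /=; try ring.
  case: (eqVneq b' j) => [->|_]; rewrite ?andbF ?andbT /=; last by ring.
  by rewrite [j == c']eq_sym; case: (c' == j) => /=; ring.
case: (eqVneq a' j) => [->|_]; rewrite ?andbF ?andbT /=; last by ring.
by rewrite [j == c']eq_sym; case: (c' == j) => /=; ring.
Qed.

(** Both sides are trilinear and agree on the basis by [RS]. The slots are freed one at a time,
    [RR_pair] and [RR_anti] moving the current one to the front, where [RR_lin] applies. *)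
Let RRS j X Y Z : RR X Y Z (B (sj j)) =
  (uf ord0 X * uf (lift ord0 j) Y - uf (lift ord0 j) X * uf ord0 Y) * uf (lift ord0 j) Z.
Proof.
set S := B (sj j); set h0 := uf ord0; set h := uf (lift ord0 j).
have lh0 : lin h0 by exact: g_lin.
have lh : lin h by exact: g_lin.
have E0 a b c : RR (B a) (B b) (B c) S = (h0 (B a) * h (B b) -
    h (B a) * h0 (B b)) * h (B c).
  by rewrite /h /h0 !ufB RB RS.
have E1 a b Z' : RR (B a) (B b) Z' S = (h0 (B a) * h (B b) - h (B a) * h0 (B b)) * h Z'.
  apply/eqP; rewrite -subr_eq0; apply/eqP.
  apply: (@lin_ext _ _ B freeB (fun Z => RR (B a) (B b) Z S - (h0 (B a) * h (B b) -
      h (B a) * h0 (B b)) * h Z)).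
    apply: linB; last exact: linZ.
    by apply: (lin_eq (RR_lin S (B a) (B b))) => W; rewrite RR_pair.
  by move=> c; rewrite E0 subrr.
have E2 a Y' Z' : RR (B a) Y' Z' S = (h0 (B a) * h Y' - h (B a) * h0 Y') * h Z'.
  apply/eqP; rewrite -subr_eq0; apply/eqP.
  apply: (@lin_ext _ _ B freeB (fun Y => RR (B a) Y Z' S - (h0 (B a) * h Y -
      h (B a) * h0 Y) * h Z')).
    apply: linB.
      by apply: (lin_eq (linZ (-1) (RR_lin (B a) Z' S))) => W; rewrite RR_anti mulN1r.
    apply: (lin_eq (linB (linZ (h0 (B a) * h Z') lh) (linZ (h (B a) * h Z') lh0))) => W.
    by ring.
  by move=> c; rewrite E1 subrr.
apply/eqP; rewrite -subr_eq0; apply/eqP.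
apply: (@lin_ext _ _ B freeB (fun X => RR X Y Z S - (h0 X * h Y - h X * h0 Y) * h Z)).
  apply: linB; first exact: RR_lin.
  apply: (lin_eq (linB (linZ (h Y * h Z) lh0) (linZ (h0 Y * h Z) lh))) => W.
  by ring.
by move=> c; rewrite E2 subrr.
Qed.

Let uf_s (i : 'I_k.+1) j : uf i (ev (sj j)) = 0.
Proof. by rewrite (ufE j) co_bvec big1 => [|l _]; rewrite ?co_bvec !dlE; ring. Qed.

Let S_uj i j : co (B (sj j)) (uj i) = 0.
Proof.
have := RRS j (ev u0) (ev (uj i)) (ev (sj i)).
rewrite uf_s mulr0 RRE (single_delta (i:=i)) => [|l il];
    rewrite /omegaV /sigmaV !co_bvec !dlE ?il ?eqxx /=; last by ring.
move=> H; apply/eqP; rewrite -oppr_eq0 -(mulrI_eq0 _ (mulfI (q_neq0 i))); apply/eqP.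
by rewrite -[RHS]H; ring.
Qed.

Let S_u0 j : co (B (sj j)) u0 = 0.
Proof.
have := RRS j (ev (uj j)) (ev (sj j)) (ev (uj j)).
rewrite !uf_s !mulr0 subrr mul0r RRE (single_delta (i:=j)) => [|l il];
    rewrite /omegaV /sigmaV !co_bvec !dlE ?il ?eqxx /=; last by ring.
move=> H; apply/eqP; rewrite -oppr_eq0 -(mulrI_eq0 _ (mulfI (q_neq0 j))); apply/eqP.
by rewrite -[RHS]H; ring.
Qed.

(* In the basis B, R(.,.,., S_j) = omega'_j (x) u'_j.  Evaluated on coordinate
   fields this makes the diagonal matrix of entries q_i s_i(S_j) a rank one
   matrix x_i y_l, so that a single component s_i(S_j) is nonzero. *)
Let S_diag j : exists i t y, [/\ y != 0, t * t = 1, eps i = eps j,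
  (forall l, co (B (sj j)) (sj l) = (l == i)%:R * t) &
  (forall b : 'I_k.+1, y * co (B (iU b)) (uj i) = (b == lift ord0 j)%:R)].
Proof.
pose h := uf (lift ord0 j); pose t l := co (B (sj j)) (sj l).
pose xx i := uf ord0 (ev u0) * h (ev (uj i)) - h (ev u0) * uf ord0 (ev (uj i)).
have E1 i l : xx i * h (ev (uj l)) = (i == l)%:R * (q i * t i).
  rewrite -(RRS j (ev u0) (ev (uj i)) (ev (uj l))) RRE (single_delta (i:=i)) => [|m im];
    rewrite /omegaV /sigmaV !S_uj !S_u0 !co_bvec !dlE ?im ?eqxx /t ?[l == i]eq_sym /=; ring.
have E0 i : xx i * h (ev u0) = 0.
  rewrite -(RRS j (ev u0) (ev (uj i)) (ev u0)) RRE (single_delta (i:=i)) => [|m im];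
    rewrite /omegaV /sigmaV !S_uj !S_u0 !co_bvec !dlE ?im ?eqxx /=; ring.
(* [S_j] has no components along d_u, so its norm involves only the [t l]. A nonzero norm yields an
   [i] with [t i != 0]; once all the other [t l] vanish, the same identity forces equal signs and
   [t i * t i = 1]. *)
have N : \sum_l eps l * (t l * t l) = eps j.
  have := gB (sj j) (sj j); rewrite /gmodel !lab_iS eqxx => <-.
  rewrite /g gPE !S_u0 !mul0r !mulr0 !addr0 add0r; apply: eq_bigr => l _.
  by rewrite !S_uj /t; ring.
have epsj0 : eps j != 0 by case: (eps_pm j) => ->; rewrite ?oppr_eq0 oner_eq0.
have [i ti] : exists i, t i != 0.
  apply/existsP; apply: contraT; rewrite negb_exists => /forallP H.
  have : eps j = 0 by rewrite -N big1 // => l _; have := H l; rewrite negbK => /eqP ->;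
      ring.
  by move/eqP; rewrite (negbTE epsj0).
have xy : xx i * h (ev (uj i)) != 0 by rewrite E1 eqxx mul1r mulf_neq0.
have [xi yi] : xx i != 0 /\ h (ev (uj i)) != 0.
  by move: xy; rewrite mulf_eq0 negb_or => /andP.
have t0 l : (i == l) = false -> t l = 0.
  move=> il; have xl : xx l = 0.
    by apply/eqP; rewrite -(mulIr_eq0 _ (mulIf yi)) E1 [l == i]eq_sym il mul0r.
  have := E1 l l; rewrite eqxx mul1r xl mul0r => /esym/eqP.
  by rewrite mulf_eq0 (negbTE (q_neq0 l)) => /eqP.
have hl l : (i == l) = false -> h (ev (uj l)) = 0.
  by move=> il; apply/eqP; rewrite -(mulrI_eq0 _ (mulfI xi)) E1 il mul0r.
have h0 : h (ev u0) = 0.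
  by apply/eqP; rewrite -(mulrI_eq0 _ (mulfI xi)) E0.
have hE l : h (ev (uj l)) = co (B (iV (lift ord0 j))) (vj l).
  rewrite /h (ufE l) co_bvec (single_delta (i:=l)) => [|m lm];
      rewrite co_bvec !dlE ?lm ?eqxx /=; ring.
have h0E : h (ev u0) = co (B (iV (lift ord0 j))) v0.
  rewrite /h (ufE j) co_bvec big1 => [|m _]; rewrite ?co_bvec !dlE /=; ring.
(* The scalar [y] is the du_i-coefficient of the covector dual to [U_j]. Its other coefficients
   vanish by [hl] and [h0], so this covector is [y] du_i. *)
exists i, (t i), (h (ev (uj i))); split=> //.
- have := N; rewrite (single_delta (i:=i)) => [|l il]; last by rewrite t0 //; ring.
  have tt : 0 <= t i * t i by rewrite -expr2 sqr_ge0.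
  case: (eps_pm i) => ->; case: (eps_pm j) => -> ; rewrite ?mul1r ?mulN1r //; try lra.
- have := N; rewrite (single_delta (i:=i)) => [|l il]; last by rewrite t0 //; ring.
  have tt : 0 <= t i * t i by rewrite -expr2 sqr_ge0.
  case: (eps_pm i) => ->; case: (eps_pm j) => -> ; rewrite ?mul1r ?mulN1r //; lra.
- move=> l; rewrite -/(t l); case: (eqVneq l i) => [->|li] /=; first by rewrite mul1r.
  by rewrite mul0r t0 // eq_sym; exact: negbTE.
- move=> b; have := ufB (lift ord0 j) (iU b); rewrite -/h /dl (inj_eq (@iU_inj k)) => <-.
  rewrite [in RHS]/h [RHS](ufE j) -h0E h0 mulr0 add0r (single_delta (i:=i)) => [|l il];
      first by rewrite hE mulrC.
  by rewrite -hE hl // mulr0.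
Qed.

(* If U_i is c^-1 d_{u_j} up to irrelevant terms, the value of nabla^m R on the
   i-th term of gamma is c ^ (2 - m) * [gcoef m j]; the powers of c cancel. *)
Definition gcoef m j : R :=
  (coefB F eps m j (co P (uj j)) - eps j * F j (co P (uj j)) ^+
      2 * coefA F m j (co P (uj j)) / q j) / q j ^+ 2.

(** With p and s the components of [U_0] along u_0 and s_i, the left side is (2 A_m p s + B_m p^2) /
    y^(m+2). R(U_0,U_j,U_j,S_j) = 1 gives q_i p t = y^2, and R(U_0,U_j,U_j,U_0) = 0 makes p s a
    multiple of p^2. So only p^2 = y^4 / q_i^2 enters, and the sign [t] disappears. *)
Let value (i j : 'I_k) (t y : R) : y != 0 -> t * t = 1 ->
  (forall l, co (B (sj j)) (sj l) = (l == i)%:R * t) ->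
  (forall l, co (B u0) (uj l) = 0) ->
  (forall l, co (B (uj j)) (uj l) = (i == l)%:R / y) ->
  forall m, teval ([:: B u0; B (uj j); B (uj j); B u0] ++
      nseq m (B (uj j))) (nablaR F eps m P)
    = y ^+ 2 / y ^+ m * gcoef m i.
Proof.
move=> y0 tt HS H0 Hj m.
set p := co (B u0) u0; set s := co (B u0) (sj i).
have q0 := q_neq0 i.
have G1 : q i * p * t = y ^+ 2.
  have := RB u0 (uj j) (uj j) (sj j); rewrite RS !dlE /= RRE.
  rewrite (single_delta (i:=i)) => [|l il];
      rewrite /omegaV /sigmaV !S_uj !S_u0 !H0 !Hj HS ?[l == i]eq_sym ?il ?eqxx /=;
      last by ring.
  rewrite -/p => E; have -> : y ^+ 2 = y ^+ 2 * ((1 * 1 - 0 * 0) * 1) by ring.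
  by rewrite -E; field.
have p2 : p ^+ 2 = y ^+ 4 / q i ^+ 2.
  have -> : y ^+ 4 = (q i * p * t) ^+ 2 by rewrite G1; ring.
  have -> : (q i * p * t) ^+ 2 = q i ^+ 2 * p ^+ 2 * (t * t) by ring.
  by rewrite tt; field.
have G2 : 2 * q i * (p * s) = - ff i * p ^+ 2.
  have := RB u0 (uj j) (uj j) u0; rewrite (_ : rmodel _ _ _ _ _ = 0); last first.
    by rewrite /rmodel !lab_iU.
  rewrite RRE (single_delta (i:=i)) => [|l il];
      rewrite /omegaV /sigmaV !H0 !Hj ?il ?eqxx /=; last by ring.
  rewrite -/p -/s => E; apply/eqP; rewrite -subr_eq0; apply/eqP.
  by rewrite -[RHS](mulr0 (y ^+ 2)) -E; field.
have ps : p * s = - ff i * p ^+ 2 / (2 * q i).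
  by rewrite -G2; field.
rewrite !cat_cons cat0s (@teval_nablaR _ _ _ _ eps_pm smF); last by rewrite size_nseq.
rewrite (single_delta (i:=i)) => [|l il]; last first.
  by rewrite /quad /omegaV /sigmaV !H0 !Hj il /=; ring.
have -> : \prod_(V <- nseq m (B (uj j))) co V (uj i) = (y ^+ m)^-1.
  by rewrite big_nseq Hj eqxx mul1r iter_mulr_1 exprVn.
have -> : quad F eps m P i (B u0) (B (uj j)) (B (uj j)) (B u0) =
   (coefA F m i (co P (uj i)) * (2 * (p * s)) + coefB F eps m i (co P (uj i)) * p ^+
       2) / y ^+ 2.
  by rewrite /quad /omegaV /sigmaV !H0 !Hj eqxx /= -/p -/s; field.
by rewrite ps p2 /gcoef /ff; field; rewrite ?q0 ?y0 ?expf_neq0.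
Qed.

Lemma gamma_normalized m : (2 <= m)%N ->
  gamma F eps m P B = \sum_j gcoef m j * gcoef 1 j ^+ (m - 2).
Proof.
move=> m2.
have [pi Hpi] := fin_all_exists S_diag.
(* If [j] and [j'] differed and shared the value i, the u_i-component of [U_j] would be nonzero by
   [Hpi j] and zero by [Hpi j']. *)
have inj_pi : injective pi.
  move=> j j' E; have [t [y [y0 _ _ _ Hy]]] := Hpi j; have [t' [y' [y'0 _ _ _ Hy']]] :=
      Hpi j'.
  have := Hy' (lift ord0 j); rewrite -E; have /eqP := Hy (lift ord0 j).
  rewrite eqxx /=; case: (eqVneq (lift ord0 j) (lift ord0 j')) => [/lift_inj -> //|_] /=.
  move=> H /eqP; rewrite mulf_eq0 (negbTE y'0) /= => /eqP H'.
  by move: H; rewrite H' mulr0 eq_sym oner_eq0.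
(* Surjectivity makes every du_i a multiple of some dual covector, which determines all
   u_i-components of [U_0] and of the [U_j]. *)
have surj i : exists j, pi j = i.
  by have [r _ rK] := injF_bij inj_pi; exists (r i); exact: rK.
have pinv (b : 'I_k.+1) i : exists y : R, exists j, [/\ pi j = i, y !=
    0 & co (B (iU b)) (uj i) = (b == lift ord0 j)%:R / y].
  have [j ji] := surj i; have [t [y [y0 _ _ _ Hy]]] := Hpi j; exists y, j; split=> //.
  by rewrite -(Hy b) -ji; field.
rewrite (reindex_inj inj_pi) /= /gamma; apply: eq_bigr => j _.
have [t [y [y0 tt _ HS Hy]]] := Hpi j.
have H0 l : co (B u0) (uj l) = 0.
  by have [y' [j' [_ _ ->]]] := pinv ord0 l; rewrite eq_liftF mul0r.
have Hj l : co (B (uj j)) (uj l) = (pi j == l)%:R / y.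
  case: (eqVneq (pi j) l) => [<-|nl] /=.
    by have := Hy (lift ord0 j); rewrite eqxx /= => <-; field.
  have [y' [j' [jl _ ->]]] := pinv (lift ord0 j) l.
  rewrite (inj_eq lift_inj); case: (eqVneq j j') => [E|_]; last by rewrite !mul0r.
  by move: nl; rewrite E jl eqxx.
rewrite (value y0 tt HS H0 Hj).
have -> : teval [:: B (iU ord0); B (iU (lift ord0 j)); B (iU (lift ord0 j)); B (iU ord0);
    B (iU (lift ord0 j))] (nablaR F eps 1 P) = y * gcoef 1 (pi j).
  by have /= -> := value y0 tt HS H0 Hj 1; rewrite expr1; field.
(* Writing [m] as [(m - 2) + 2] splits [y ^+ m] into the two powers that cancel. *)
rewrite exprMn -(subnK m2) addnK exprD; field.
by rewrite y0 expf_neq0.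
Qed.

End Normalized.

(** * The coefficients behind the formula for gamma_2 *)

Section Gamma2.
Variables (R : realType) (k : nat) (F : 'I_k -> R -> R) (eps : 'I_k -> R).
Hypothesis smF : forall j, smoothR (F j).

Lemma coefB1E j : coefB F eps 1 j = fun u => 2 * eps j * F j u * (2 * derive1 (F j) u + 1).
Proof.
apply/funext => u /=.
have dF v : derivable (F j) v 1 by apply: smoothR_derivable; exact: smF.
have dFF v : derivable (fun u => F j u * F j u) v 1 by exact: (derivableM (dF v) (dF v)).
rewrite (derive1M_fun (f := fun=> eps j) _ dFF); last by move=> v; exact: derivable_cst.
rewrite derive1_cst (derive1M_fun dF dF) /coefA /=; ring.
Qed.

(** The coefficient 6 is 4 + 2: 4 from differentiating 4 f f' in [coefB 1], and 2 from the new term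
    2 f A_1 with A_1 = f''. *)
Lemma coefB2E j u : coefB F eps 2 j u = eps j * (4 * derive1n 1 (F j) u ^+ 2 +
  2 * derive1n 1 (F j) u + 6 * F j u * derive1n 2 (F j) u).
Proof.
have dF v : derivable (F j) v 1 by apply: smoothR_derivable; exact: smF.
have dF1 v : derivable (derive1 (F j)) v 1 by apply: smoothR_derivable;
    apply: smoothR_derive1; exact: smF.
have dc (c : R) v : derivable (fun _ : R => c) v 1 by exact: derivable_cst.
rewrite -[LHS]/(derive1 (coefB F eps 1 j) u + 2 * eps j * (F j u * coefA F 1 j u)) coefB1E.
have d2 v : derivable (fun u =>
    2 * derive1 (F j) u) v 1 by exact: (derivableM (dc 2 v) (dF1 v)).
have d3 v : derivable (fun u => 2 * derive1 (F j) u +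
    1) v 1 by exact: (derivableD (d2 v) (dc 1 v)).
have d4 v : derivable (fun u =>
    2 * eps j * F j u) v 1 by exact: (derivableM (dc (2 * eps j) v) (dF v)).
rewrite (derive1M_fun d4 d3) (derive1M_fun (dc (2 * eps j)) dF) (derive1D_fun d2 (dc 1))
    (derive1M_fun (dc 2) dF1).
rewrite !derive1_cst /coefA /= (derive1D_fun dF1 (dc 1)) derive1_cst; ring.
Qed.

Lemma coefA2E j u : coefA F 2 j u = derive1n 3 (F j) u.
Proof.
have dF1 v : derivable (derive1 (F j)) v 1 by apply: smoothR_derivable;
    apply: smoothR_derive1; exact: smF.
have dc (c : R) v : derivable (fun _ : R => c) v 1 by exact: derivable_cst.
rewrite /coefA /= (derive1D_fun dF1 (dc 1)); congr (derive1 _ u).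
by apply/funext => v; rewrite derive1_cst addr0.
Qed.

End Gamma2.

(** * Naturality of the covariant derivatives under local isometries *)

Section Chain.
Variables (R : realType) (k : nat).
Notation I := 'I_(Mdim k).
Notation ev := (@bvec R k).
Implicit Types (x v : pt R k) (c : I).

Lemma hasD_coV (f : pt R k -> pt R k) x v c : differentiable f x ->
  hasD (fun y => co (f y) c) x v (co (derive f x v) c).
Proof.
move=> df; split.
  apply: (@differentiable_comp _ _ _ _ f (fun y : pt R k => co y c)) => //.
  exact: differentiable_coord.
have dv : derivable f x v by exact: diff_derivable.
by rewrite (derive_mx dv) /co mxE.
Qed.

Lemma derive_pd (h : pt R k -> R) x v : differentiable h x ->
  derive h x v = \sum_c co v c * pd c h x.
Proof.
move=> dh; rewrite (deriveE v dh) [in LHS](row_sum_delta v) linear_sum /=.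
by apply: eq_bigr => c _; rewrite linearZ /pd (deriveE _ dh).
Qed.

Lemma hasD_comp (h : pt R k -> R) (f : pt R k -> pt R k) x v :
  differentiable f x -> differentiable h (f x) ->
  hasD (fun y => h (f y)) x v (\sum_c co (derive f x v) c * pd c h (f x)).
Proof.
move=> df dh; have dhf : differentiable (h \o f) x by exact: differentiable_comp.
split; first exact: dhf.
have E2 := deriveE v df; have E3 := deriveE (derive f x v) dh.
have E4 := diff_comp df dh.
rewrite -(derive_pd _ dh) E3 E2; apply: etrans (deriveE v dhf) _.
exact: (congr1 (fun F => F v) E4).
Qed.

(* The derivation of [teval] in its vector arguments: the sum over the slots of
   [l] of the value with [X a] replaced by [D a] in that slot. *)
Fixpoint teval_der (X D : I -> pt R k) (l : seq I) (t : seq I -> R) : R :=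
  if l is a :: l' then teval (D a :: map X l') t
    + \sum_p co (X a) p * teval_der X D l' (fun l => t (p :: l))
  else 0.

(** Chain rule for the moving base point [f y], plus Leibniz rule for the moving arguments
    [X a y]. *)
Lemma hasD_teval (X : I -> pt R k -> pt R k) (f : pt R k -> pt R k) (T : tfield R k) l x v :
  differentiable f x -> (forall a, differentiable (X a) x) ->
  (forall l', size l' = size l -> differentiable (fun y => T y l') (f x)) ->
  hasD (fun y => teval [seq X a y | a <- l] (T (f y))) x v
   (\sum_c co (derive f x v) c * teval [seq X a x | a <- l] (fun l' => pd c (fun y =>
       T y l') (f x))
    + teval_der (X^~ x) (fun a => derive (X a) x v) l (T (f x))).
Proof.
move=> df dX; elim: l T => [|a l IH] T dT.
  by rewrite /= addr0; apply: (hasD_comp v df); exact: (dT [::]).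
apply: hasD_eq.
  apply: (@hasD_sum _ _ _ (fun p y =>
      co (X a y) p * teval [seq X a y | a <- l] (fun l' => T (f y) (p :: l'))) x v
    (fun p => co (derive (X a) x v) p * teval [seq X a x | a <- l] (fun l' =>
        T (f x) (p :: l'))
     + co (X a x) p * (\sum_c co (derive f x v) c * teval [seq X a x | a <- l] (fun l' =>
         pd c (fun y => T y (p :: l')) (f x))
    + teval_der (X^~ x) (fun a => derive (X a) x v) l (fun l' => T (f x) (p :: l'))))) => p.
  apply: hasDM; first exact: hasD_coV.
  apply: (IH (fun y l' => T y (p :: l'))) => l' sl'.
  by apply: (dT (p :: l')); rewrite /= sl'.
rewrite big_split /=; under [X in _ + X]eq_bigr do rewrite mulrDr.
rewrite big_split /= addrCA; congr (_ + _).
under eq_bigr do rewrite mulr_sumr.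
rewrite exchange_big; apply: eq_bigr => c _; rewrite mulr_sumr.
by apply: eq_bigr => p _; rewrite mulrCA.
Qed.

Lemma teval_der_lin n (q : 'I_n -> R) (X D : I -> pt R k) (E : 'I_n -> I -> pt R k) l t :
  (forall a c, co (D a) c = \sum_i q i * co (E i a) c) ->
  teval_der X D l t = \sum_i q i * teval_der X (E i) l t.
Proof.
move=> H; elim: l t => [|a l IH] t /=.
  by rewrite big1 // => i _; rewrite mulr0.
under [RHS]eq_bigr do rewrite mulrDr.
rewrite big_split /=; congr (_ + _).
  under [RHS]eq_bigr do rewrite mulr_sumr.
  rewrite exchange_big; apply: eq_bigr => c _; rewrite -/(co _ _) H mulr_suml.
  by apply: eq_bigr => i _; rewrite -mulrA.
under eq_bigr do rewrite IH mulr_sumr.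
rewrite exchange_big; apply: eq_bigr => i _; rewrite mulr_sumr.
by apply: eq_bigr => p _; rewrite mulrCA.
Qed.

Lemma teval_derB (X D1 D2 D : I -> pt R k) l t :
  (forall a c, co (D a) c = co (D1 a) c - co (D2 a) c) ->
  teval_der X D l t = teval_der X D1 l t - teval_der X D2 l t.
Proof.
move=> H; elim: l t => [|a l IH] t /=; first by rewrite subr0.
have -> : \sum_a0 D a ord0 a0 * teval [seq X i | i <- l] (fun l0 => t (a0 :: l0)) =
  \sum_a0 D1 a ord0 a0 * teval [seq X i | i <- l] (fun l0 => t (a0 :: l0)) -
  \sum_a0 D2 a ord0 a0 * teval [seq X i | i <- l] (fun l0 => t (a0 :: l0)).
  by rewrite -sumrB; apply: eq_bigr => c _; rewrite -!/(co _ _) H mulrBl.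
have -> : \sum_p co (X a) p * teval_der X D l (fun l0 => t (p :: l0)) =
  \sum_p co (X a) p * teval_der X D1 l (fun l0 => t (p :: l0)) -
  \sum_p co (X a) p * teval_der X D2 l (fun l0 => t (p :: l0)).
  by rewrite -sumrB; apply: eq_bigr => c _; rewrite IH mulrBr.
by rewrite opprD addrACA.
Qed.

Lemma corr_ext (N : I -> I -> R) l t t' : (forall l', size l' = size l -> t l' = t' l') ->
  corr N l t = corr N l t'.
Proof.
elim: l t t' => [//|a l IH] t t' H /=; congr (_ + _).
  by apply: eq_bigr => c _; rewrite H.
by apply: IH => l' sl'; apply: H; rewrite /= sl'.
Qed.

Lemma corr_sum (N : I -> I -> R) l n (q : 'I_n -> R) (t : 'I_n -> seq I -> R) :
  corr N l (fun l => \sum_i q i * t i l) = \sum_i q i * corr N l (t i).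
Proof.
elim: l t => [|a l IH] t /=; first by rewrite big1 // => i _; rewrite mulr0.
rewrite IH; under [RHS]eq_bigr do rewrite mulrDr.
rewrite big_split /=; congr (_ + _).
under eq_bigr do rewrite mulr_sumr.
rewrite exchange_big; apply: eq_bigr => i _; rewrite mulr_sumr.
by apply: eq_bigr => p _; rewrite mulrCA.
Qed.

(** Here the correction acts on the labels of the frame [X] (source side), in [teval_corr] on the
    components of the tensor (target side). Both become a [teval_der], which makes the two
    connections comparable. *)
Lemma corr_teval_der (N : I -> I -> R) (X D : I -> pt R k) l t :
  (forall a c, co (D a) c = \sum_b N a b * co (X b) c) ->
  corr N l (fun l => teval (map X l) t) = teval_der X D l t.
Proof.
move=> H; elim: l t => [//|a l IH] t /=; congr (_ + _).
  under eq_bigr do rewrite mulr_sumr.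
  rewrite exchange_big; apply: eq_bigr => c _; rewrite -/(co _ _) H mulr_suml.
  by apply: eq_bigr => b _; rewrite -mulrA.
rewrite (corr_sum N l (co (X a)) (fun p l => teval (map X l) (fun l => t (p :: l)))).
by apply: eq_bigr => p _; rewrite IH.
Qed.

Lemma teval_corr (N : I -> I -> R) (X D : I -> pt R k) l t :
  (forall a c, co (D a) c = \sum_b co (X a) b * N b c) ->
  teval (map X l) (fun l => corr N l t) = teval_der X D l t.
Proof.
move=> H; elim: l t => [//|a l IH] t /=.
under eq_bigr do rewrite tevalD mulrDr.
rewrite big_split /=; congr (_ + _); last first.
  by apply: eq_bigr => p _; rewrite -IH.
under eq_bigr do rewrite (teval_sum (fun c l => N _ c * t (c :: l))) mulr_sumr.
rewrite exchange_big; apply: eq_bigr => c _; rewrite -/(co _ _) H mulr_suml.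
by apply: eq_bigr => b _; rewrite tevalZ mulrA.
Qed.

Lemma teval_rcons (Xs : seq (pt R k)) Y t :
  teval (rcons Xs Y) t = \sum_c co Y c * teval Xs (fun l => t (rcons l c)).
Proof.
elim: Xs t => [|X Xs IH] t //=.
under eq_bigr do rewrite IH mulr_sumr.
rewrite exchange_big; apply: eq_bigr => c _; rewrite mulr_sumr.
by apply: eq_bigr => p _; rewrite mulrCA.
Qed.

Lemma teval_mulmx (M : 'M[R]_(Mdim k)) (X : I -> pt R k) Xs t :
  (forall a c, M a c = co (X a) c) ->
  teval (map (fun Y : pt R k => ((Y : 'rV[R]_(Mdim k)) *m M : pt R k)) Xs) t =
  teval Xs (fun l => teval (map X l) t).
Proof.
move=> H; elim: Xs t => [//|Y Xs IH] t /=.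
have E a : teval Xs (fun l => \sum_p X a ord0 p * teval (map X l) (fun l => t (p :: l))) =
    \sum_p co (X a) p * teval Xs (fun l => teval (map X l) (fun l => t (p :: l))).
  rewrite (teval_sum (fun p l => X a ord0 p * teval (map X l) (fun l => t (p :: l)))).
  by apply: eq_bigr => p _; rewrite tevalZ.
under [RHS]eq_bigr do rewrite E mulr_sumr.
rewrite exchange_big; apply: eq_bigr => p _; rewrite IH mxE mulr_suml.
by apply: eq_bigr => a _; rewrite H mulrA.
Qed.
End Chain.

Section Isometry.
Variables (R : realType) (k : nat) (F : 'I_k -> R -> R) (eps : 'I_k -> R).
Notation I := 'I_(Mdim k).
Notation ev := (@bvec R k).
Implicit Types (a b c d e : I) (x X Y : pt R k).
Hypothesis eps_pm : forall i, eps i = 1 \/ eps i = -1.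
Hypothesis smF : forall j, smoothR (F j).
Variables (U : set (pt R k)) (phi : pt R k -> pt R k).
Hypothesis openU : open U.
Hypothesis smphi : smooth_on U phi.
Hypothesis isom : forall x, U x -> forall X Y,
  gP F eps (phi x) (derive phi x X) (derive phi x Y) = gP F eps x X Y.

Let J a x : pt R k := derive phi x (ev a).
Let H a b x : pt R k := derive (J b) x (ev a).
Let g x X Y := gP F eps x X Y.

Let dphi x : U x -> differentiable phi x. Proof. exact: (smphi [::]). Qed.
Let dJ a x : U x -> differentiable (J a) x. Proof. exact: (smphi [:: ev a]). Qed.
Let dH a b x : U x -> differentiable (H a b) x. Proof. exact: (smphi [:: ev a; ev b]). Qed.

Let nearU x (Q : pt R k -> Prop) : U x -> (forall y, U y -> Q y) -> \forall y \near x, Q y.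
Proof. by move=> Ux HQ; apply: filterS (open_nbhs_nbhs (conj openU Ux)). Qed.

Let derive_eqU (f h : pt R k -> R) x v : U x -> (forall y, U y -> f y = h y) ->
  derive f x v = derive h x v.
Proof. by move=> Ux E; apply: near_eq_derive; exact: nearU. Qed.

Let symH a b x : U x -> H a b x = H b a x.
Proof.
move=> Ux; apply/rowP => c.
have E a' b' : derive (fun y => co (J b' y) c) x (ev a') = H a' b' x ord0 c.
  exact: (hasD_derive (hasD_coV (ev a') c (dJ b' Ux))).
apply: etrans (esym (E a b)) _; apply: etrans _ (E b a).
apply: (@derive_comm _ _ (fun y => co (phi y) c)).
- by apply: (nearU Ux) => y Uy; apply: hasD_coV; exact: dphi.
- by apply: (nearU Ux) => y Uy; apply: hasD_coV; exact: dphi.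
- by have [] := hasD_coV 0 c (dJ b Ux).
- by have [] := hasD_coV 0 c (dJ a Ux).
Qed.

Let symH3 a b c e x : U x ->
  derive (fun y => co (H b c y) e) x (ev a) = derive (fun y => co (H a c y) e) x (ev b).
Proof.
move=> Ux; apply: (@derive_comm _ _ (fun y => co (J c y) e)).
- by apply: (nearU Ux) => y Uy; apply: hasD_coV; exact: dJ.
- by apply: (nearU Ux) => y Uy; apply: hasD_coV; exact: dJ.
- by have [] := hasD_coV 0 e (dH b c Ux).
- by have [] := hasD_coV 0 e (dH a c Ux).
Qed.

(** Packages the metric as a component field, so that [hasD_teval] differentiates the isometry
    condition. *)
Definition metric_field : tfield R k := fun y l =>
  if l is [:: a; b] then gcomp F eps y a b else 0.

Let gE x X Y : g x X Y = teval [:: X; Y] (metric_field x).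
Proof.
rewrite /g /gP /=; apply: eq_bigr => a _; rewrite mulr_sumr; apply: eq_bigr => b _.
by rewrite -mulrA [_ * Y _ _]mulrC.
Qed.

Let g_mx x X Y : g x X Y =
  ((X : 'rV[R]_(Mdim k)) *m gmat F eps x *m (Y : 'rV[R]_(Mdim k))^T) ord0 ord0.
Proof.
rewrite mxE /g /gP exchange_big; apply: eq_bigr => b _.
by rewrite !mxE mulr_suml; apply: eq_bigr => a _; rewrite mxE.
Qed.

Let gC x X Y : g x X Y = g x Y X.
Proof.
rewrite /g /gP exchange_big; apply: eq_bigr => b _; apply: eq_bigr => a _.
by rewrite gcompC; ring.
Qed.

Let gcompU x a b : U x -> gcomp F eps x a b = teval [:: J a x;
    J b x] (metric_field (phi x)).
Proof.
move=> Ux; rewrite -gE /J /g isom // -/(g _ _ _) gE.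
by rewrite (teval_bvec [:: a; b] (metric_field x)).
Qed.

Let dmetric l y : differentiable (fun y => metric_field y l) y.
Proof.
case: l => [|a [|b [|c l]]]; try exact: differentiable_cst.
by have [] := hasD_gcomp eps smF a b y 0.
Qed.

Let DG e a b x : R := \sum_c co (J e x) c * teval [:: J a x; J b x]
   (fun l => pd c (fun y => metric_field y l) (phi x)).

Let pd_metric e a b x : U x -> pd e (fun y => gcomp F eps y a b) x =
  DG e a b x + g (phi x) (H e a x) (J b x) + g (phi x) (J a x) (H e b x).
Proof.
move=> Ux; rewrite /pd.
rewrite (@derive_eqU _ (fun y => teval [seq J a y | a <- [:: a;
    b]] (metric_field (phi y)))) //; last first.
  by move=> y Uy; exact: gcompU.
have dJx c : differentiable (J c) x by exact: dJ.
rewrite (hasD_derive (hasD_teval (ev e) (dphi Ux) dJx (fun l _ => dmetric l _))).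
rewrite /DG -addrA; congr (_ + _); rewrite !gE /=; congr (_ + _).
apply: eq_bigr => p _; congr (_ * _); rewrite [X in _ + X]big1 ?addr0 // => c _.
exact: mulr0.
Qed.

Let Mx x : 'M[R]_(Mdim k) := \matrix_(a, c) co (J a x) c.

Let Mx_gmat x : U x -> Mx x *m gmat F eps (phi x) *m (Mx x)^T = gmat F eps x.
Proof.
move=> Ux; apply/matrixP => a b; rewrite [RHS]mxE gcompU // -gE g_mx !mxE.
apply: eq_bigr => c _; rewrite !mxE; congr (_ * _); apply: eq_bigr => d _.
by rewrite !mxE.
Qed.

(** The isometry condition is a congruence between metric matrices; the invertibility of the source
    metric passes to its factors. *)
Let Mx_unit x : U x -> Mx x \in unitmx.
Proof.
move=> Ux; have := gmat_unit F eps_pm x; rewrite -Mx_gmat // !unitmx_mul.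
by case/andP => /andP[].
Qed.

Let g_nondeg x (W : pt R k) : U x -> (forall d, g (phi x) W (J d x) = 0) -> forall c,
    co W c = 0.
Proof.
move=> Ux HW c.
have E : (W : 'rV[R]_(Mdim k)) *m gmat F eps (phi x) *m (Mx x)^T = 0.
  apply/rowP => d; rewrite [RHS]mxE -[RHS](HW d) g_mx !mxE; apply: eq_bigr => e _.
  by rewrite !mxE.
have Ut : (Mx x)^T \in unitmx by rewrite unitmx_tr; exact: Mx_unit.
have W0 : (W : 'rV[R]_(Mdim k)) = 0.
  by rewrite -(mulmxK (gmat_unit F eps_pm (phi x)) W) -(mulmxK Ut (_ *m gmat F eps _)) E
      !mul0mx.
by rewrite /co W0 mxE.
Qed.

Let g_suml n (q : 'I_n -> R) (E : 'I_n -> pt R k) W x Y :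
  (forall c, co W c = \sum_i q i * co (E i) c) -> g x W Y = \sum_i q i * g x (E i) Y.
Proof.
move=> HW; rewrite gE /=; under [RHS]eq_bigr do rewrite gE /= mulr_sumr.
rewrite exchange_big; apply: eq_bigr => c _; rewrite -/(co W c) HW mulr_suml.
by apply: eq_bigr => i _; rewrite -mulrA.
Qed.

Let g_sub W1 W2 W x Y : (forall c, co W c = co W1 c - co W2 c) -> g x W Y = g x W1 Y -
    g x W2 Y.
Proof.
move=> HW; rewrite !gE /= -sumrB; apply: eq_bigr => c _.
by rewrite -!/(co _ _) HW mulrBl.
Qed.

(** Not a tensor: the bilinear array of Christoffel symbols with fixed upper index, put in this form
    so that [hasD_teval] differentiates it along [phi]. *)
Definition gam_field f : tfield R k := fun y l =>
  if l is [:: a; b] then Gam F eps f a b y else 0.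

Definition GamV y X Y : pt R k := \row_f teval [:: X; Y] (gam_field f y).

Let co_GamV y X Y f : co (GamV y X Y) f = teval [:: X; Y] (gam_field f y).
Proof. by rewrite /co mxE. Qed.

Let S3 x a b d (h : I -> I -> I -> R) :=
    \sum_p co (J a x) p * \sum_q co (J b x) q * \sum_r co (J d x) r * h p q r.

Let DG1 a b d x : S3 x a b d (fun p q r => pd p (fun y => gcomp F eps y q r) (phi x)) =
    DG a b d x.
Proof. by []. Qed.

Let DG2 a b d x : S3 x a b d (fun p q r => pd q (fun y => gcomp F eps y p r) (phi x)) =
    DG b a d x.
Proof.
rewrite /DG /S3 /=.
under [RHS]eq_bigr do rewrite mulr_sumr.
rewrite exchange_big /=; apply: eq_bigr => p _; rewrite mulr_sumr.
by apply: eq_bigr => q _; rewrite mulrCA.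
Qed.

Let DG3 a b d x : S3 x a b d (fun p q r => pd r (fun y => gcomp F eps y p q) (phi x)) =
    DG d a b x.
Proof.
rewrite /DG /S3 /=.
under [RHS]eq_bigr do rewrite mulr_sumr.
rewrite exchange_big /=; apply: eq_bigr => p _.
under [RHS]eq_bigr do rewrite mulrCA mulr_sumr.
rewrite -mulr_sumr exchange_big /=; congr (_ * _); apply: eq_bigr => q _; rewrite mulr_sumr.
by apply: eq_bigr => r _; rewrite mulrCA.
Qed.

Let S3_low a b d x : S3 x a b d (fun p q r => lowGam F eps p q r (phi x)) =
   2^-1 * (DG a b d x + DG b a d x - DG d a b x).
Proof.
rewrite -DG1 -DG2 -DG3.
rewrite /S3 -big_split /= -sumrB mulr_sumr; apply: eq_bigr => p _.
rewrite -mulrDr -mulrBr mulrCA; congr (_ * _).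
rewrite -big_split /= -sumrB mulr_sumr; apply: eq_bigr => q _.
rewrite -mulrDr -mulrBr mulrCA; congr (_ * _).
rewrite -big_split /= -sumrB mulr_sumr; apply: eq_bigr => r _.
by rewrite -mulrDr -mulrBr mulrCA.
Qed.

(* Koszul: the second derivatives of phi are the defect of tensoriality of the
   Christoffel symbols. *)
Let lowGamU a b d x : U x -> lowGam F eps a b d x =
  S3 x a b d (fun p q r => lowGam F eps p q r (phi x)) + g (phi x) (H a b x) (J d x).
Proof.
move=> Ux; rewrite S3_low {1}/lowGam !pd_metric // (symH b a Ux) (symH d a Ux) (symH d b
    Ux).
move: (gC (phi x)); move: (g (phi x)) (H a b x) (H a d x) (H b d x) (J a x) (J b x) (J d x).
move: (DG a b d x) (DG b a d x) (DG d a b x) => D1 D2 D3 G Hab Had Hbd Ja Jb Jd GC.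
by rewrite (GC Jb) (GC Ja Hbd); field.
Qed.

(** The transformation law of Christoffel symbols: [lowGamU] with the index raised, since both sides
    pair equally with every [J d x] and these span. *)
Let HE a b x e : U x -> co (H a b x) e =
  \sum_c Gam F eps c a b x * co (J c x) e - co (GamV (phi x) (J a x) (J b x)) e.
Proof.
move=> Ux.
pose W1 : pt R k := \row_e (\sum_c Gam F eps c a b x * co (J c x) e).
have cW1 f : co W1 f = \sum_c Gam F eps c a b x * co (J c x) f by rewrite /co mxE.
pose W2 : pt R k := W1 - GamV (phi x) (J a x) (J b x).
have cW2 f : co W2 f = co W1 f - co (GamV (phi x) (J a x) (J b x)) f by rewrite /co !mxE.
pose W : pt R k := W2 - H a b x.
have cW f : co W f = co W2 f - co (H a b x) f by rewrite /co !mxE.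
suff W0 : co W e = 0 by rewrite -cW1 -cW2; apply/eqP; rewrite eq_sym -subr_eq0 -cW W0.
apply: (g_nondeg Ux) => d.
rewrite (g_sub _ _ cW) (g_sub _ _ cW2) (g_suml _ _ cW1).
have -> : \sum_i Gam F eps i a b x * g (phi x) (J i x) (J d x) = lowGam F eps a b d x.
  rewrite -Gam_low //; apply: eq_bigr => c _; rewrite gcompU // gE //.
have -> : g (phi x) (GamV (phi x) (J a x) (J b x)) (J d x) =
    S3 x a b d (fun p q r => lowGam F eps p q r (phi x)).
  rewrite gE /= /S3.
  under eq_bigr do rewrite -/(co _ _) co_GamV /= mulr_suml.
  rewrite exchange_big; apply: eq_bigr => p _.
  under eq_bigr do rewrite -mulrA.
  rewrite -mulr_sumr; congr (_ * _).
  under eq_bigr do rewrite mulr_suml.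
  rewrite exchange_big; apply: eq_bigr => q _.
  under eq_bigr do rewrite -mulrA.
  rewrite -mulr_sumr; congr (_ * _).
  under eq_bigr do rewrite mulr_sumr.
  rewrite exchange_big; apply: eq_bigr => r _; rewrite -Gam_low // mulr_sumr.
  by apply: eq_bigr => c _; rewrite mulrCA.
by rewrite lowGamU //; ring.
Qed.

Let dgam f l y : differentiable (fun y => gam_field f y l) y.
Proof.
case: l => [|a [|b [|c l]]]; try exact: differentiable_cst.
by have [] := hasD_Gam eps_pm smF f a b y 0.
Qed.

Let GV x f X Y := teval [:: X; Y] (gam_field f (phi x)).

Let GV_sumr x f X W n (q : 'I_n -> R) (E : 'I_n -> pt R k) :
  (forall c, co W c = \sum_i q i * co (E i) c) -> GV x f X W = \sum_i q i * GV x f X (E i).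
Proof.
move=> HW; rewrite /GV /=; under [RHS]eq_bigr do rewrite mulr_sumr.
rewrite exchange_big /=; apply: eq_bigr => p _.
under [RHS]eq_bigr do rewrite mulrCA.
rewrite -mulr_sumr; congr (_ * _); under [RHS]eq_bigr do rewrite mulr_sumr.
rewrite exchange_big /=; apply: eq_bigr => r _; rewrite -/(co W r) HW mulr_suml.
by apply: eq_bigr => i _; rewrite -mulrA.
Qed.

Let GV_subr x f X W W1 W2 : (forall c, co W c = co W1 c - co W2 c) ->
  GV x f X W = GV x f X W1 - GV x f X W2.
Proof.
move=> HW; rewrite /GV /= -sumrB; apply: eq_bigr => p _.
rewrite -mulrBr; congr (_ * _); rewrite -sumrB; apply: eq_bigr => r _.
by rewrite -!/(co _ _) HW mulrBl.
Qed.

Let S3_swap x a b d (h : I -> I -> I -> R) : S3 x a b d (fun p q r => h q p r) =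
    S3 x b a d h.
Proof.
rewrite /S3; under eq_bigr do rewrite mulr_sumr.
rewrite exchange_big /=; apply: eq_bigr => q _; rewrite mulr_sumr.
by apply: eq_bigr => p _; rewrite mulrCA.
Qed.

Let S3_sub x a b d (h1 h2 : I -> I -> I -> R) :
  S3 x a b d (fun p q r => h1 p q r - h2 p q r) = S3 x a b d h1 - S3 x a b d h2.
Proof.
rewrite /S3 -sumrB; apply: eq_bigr => p _; rewrite -mulrBr; congr (_ * _).
rewrite -sumrB; apply: eq_bigr => q _; rewrite -mulrBr; congr (_ * _).
by rewrite -sumrB; apply: eq_bigr => r _; rewrite -mulrBr.
Qed.

Let S3_add x a b d (h1 h2 : I -> I -> I -> R) :
  S3 x a b d (fun p q r => h1 p q r + h2 p q r) = S3 x a b d h1 + S3 x a b d h2.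
Proof.
rewrite /S3 -big_split /=; apply: eq_bigr => p _; rewrite -mulrDr; congr (_ * _).
rewrite -big_split /=; apply: eq_bigr => q _; rewrite -mulrDr; congr (_ * _).
by rewrite -big_split /=; apply: eq_bigr => r _; rewrite -mulrDr.
Qed.

Let dK f a b c x := S3 x a b c (fun p q r => pd p (Gam F eps f q r) (phi x)).
Let Q f a b c x := GV x f (J a x) (GamV (phi x) (J b x) (J c x)).

Let dHE f a b c x : U x -> derive (fun y => co (H b c y) f) x (ev a) =
  \sum_h (pd a (Gam F eps h b c) x * co (J h x) f + Gam F eps h b c x * co (H a h x) f)
  - (dK f a b c x + (GV x f (H a b x) (J c x) + GV x f (J b x) (H a c x))).
Proof.
move=> Ux.
have dJx e : differentiable (J e) x by exact: dJ.
have E y : U y -> co (H b c y) f = \sum_h Gam F eps h b c y * co (J h y) f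
    + - teval [seq J e y | e <- [:: b; c]] (gam_field f (phi y)).
  by move=> Uy; rewrite HE // co_GamV.
rewrite (derive_eqU _ Ux E).
have E1 : hasD (fun y => \sum_h Gam F eps h b c y * co (J h y) f) x (ev a)
    (\sum_h (pd a (Gam F eps h b c) x * co (J h x) f + Gam F eps h b c x * co (H a h x) f)).
  apply: hasD_sum => h; apply: hasDM; last exact: hasD_coV.
  by apply: differentiable_hasD; have [] := hasD_Gam eps_pm smF h b c x 0.
rewrite (hasD_derive (hasDD E1 (hasDN (hasD_teval (ev a) (dphi Ux) dJx (fun l _ =>
    dgam f l _))))).
congr (_ - (_ + _)); rewrite /GV /=; congr (_ + _).
by apply: eq_bigr => p _; congr (_ * _); rewrite [X in _ + X]big1 ?addr0 // => e _;
    exact: mulr0.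
Qed.

Let S3_Q f a b c x : S3 x a b c (fun p q r =>
    \sum_e Gam F eps e q r (phi x) * Gam F eps f p e (phi x))
  = Q f a b c x.
Proof.
rewrite /S3 /Q /GV /=; apply: eq_bigr => p _; congr (_ * _).
under [RHS]eq_bigr => e _.
  rewrite -/(co _ e) co_GamV /= mulr_suml.
  under eq_bigr do rewrite -mulrA mulr_suml mulr_sumr.
  over.
rewrite exchange_big /=; apply: eq_bigr => q _; rewrite mulr_sumr.
rewrite [RHS]exchange_big /=; apply: eq_bigr => r _; rewrite !mulr_sumr.
by apply: eq_bigr => e _; rewrite -[in RHS]mulrA.
Qed.

(* The identity [HE] for the second derivatives of phi, differentiated once more
   and antisymmetrized: the third derivatives of phi cancel. *)
Let curvU f a b c x : U x -> \sum_h Rcoef F eps h a b c x * co (J h x) f =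
  S3 x a b c (fun p q r => Rcoef F eps f p q r (phi x)).
Proof.
move=> Ux.
pose A a b := \sum_h (\sum_e Gam F eps e b c x * Gam F eps h a e x) * co (J h x) f.
(* [V] collects the mixed products of a source and a target Christoffel symbol. They cancel on
   antisymmetrization, as does the term in [H a b x] by [symH]. *)
pose V a b := \sum_h Gam F eps h b c x * GV x f (J a x) (J h x).
pose T a b := \sum_h pd a (Gam F eps h b c) x * co (J h x) f.
have E1 : \sum_h Rcoef F eps h a b c x * co (J h x) f = T a b - T b a + (A a b - A b a).
  rewrite /T /A -!sumrB -big_split /=; apply: eq_bigr => h _ /=.
  by rewrite /Rcoef sumrB mulrDl !mulrBl.
have E2 : S3 x a b c (fun p q r => Rcoef F eps f p q r (phi x)) =
    dK f a b c x - dK f b a c x + (Q f a b c x - Q f b a c x).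
  rewrite -!S3_Q /dK -(S3_swap x a b c (fun p q r => pd p (Gam F eps f q r) (phi x))).
  rewrite -(S3_swap x a b c (fun p q r =>
      \sum_e Gam F eps e q r (phi x) * Gam F eps f p e (phi x))).
  rewrite -!S3_sub -S3_add; apply: eq_bigr => p _; congr (_ * _).
  apply: eq_bigr => q _; congr (_ * _); apply: eq_bigr => r _; congr (_ * _).
  by rewrite /Rcoef sumrB.
have E3 a' b' : \sum_h Gam F eps h b' c x * co (H a' h x) f = A a' b' - V a' b'.
  have -> : A a' b' = \sum_h Gam F eps h b' c x * \sum_e Gam F eps e a' h x * co (J e x) f.
    rewrite /A; under eq_bigr do rewrite mulr_suml.
    rewrite exchange_big /=; apply: eq_bigr => h _; rewrite mulr_sumr.
    by apply: eq_bigr => e _; rewrite mulrA.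
  by rewrite /V -sumrB; apply: eq_bigr => h _; rewrite HE // co_GamV -mulrBr.
have E4 a' b' : GV x f (J b' x) (H a' c x) = V b' a' - Q f b' a' c x.
  pose W : pt R k := \row_e (\sum_h Gam F eps h a' c x * co (J h x) e).
  have cW e : co W e = \sum_h Gam F eps h a' c x * co (J h x) e by rewrite /co mxE.
  rewrite (GV_subr _ _ _ (W1 := W) (W2 := GamV (phi x) (J a' x) (J c x))); last first.
    by move=> e; rewrite cW HE.
  by rewrite (GV_sumr _ _ _ cW).
have E5 a' b' : derive (fun y => co (H b' c y) f) x (ev a') =
    T a' b' + (A a' b' - V a' b') - (dK f a' b' c x +
      (GV x f (H a' b' x) (J c x) + (V b' a' - Q f b' a' c x))).
  by apply: etrans (dHE f a' b' c Ux) _; rewrite E4 big_split /= E3.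
have := etrans (esym (E5 a b)) (etrans (symH3 a b c f Ux) (E5 b a)).
rewrite (symH b a Ux).
rewrite E1 E2.
move: (T a b) (T b a) (A a b) (A b a) (V a b) (V b a) (Q f a b c x) (Q f b a c x) (dK f a
    b c x) (dK f b a c x).
move: (GV x f (H a b x) (J c x)) => t1 t2 t3 t4 t5 t6 t7 t8 t9 t10 t11 E.
apply/eqP; rewrite -subr_eq0; apply/eqP; move/eqP: E; rewrite -subr_eq0 => /eqP <-; ring.
Qed.

Let RcompU a b c d x : U x -> Rcomp F eps x a b c d =
  teval [:: J a x; J b x; J c x; J d x] (Rtens F eps (phi x)).
Proof.
move=> Ux; rewrite /Rcomp.
pose W : pt R k := \row_f (\sum_h Rcoef F eps h a b c x * co (J h x) f).
have cW f : co W f = \sum_h Rcoef F eps h a b c x * co (J h x) f by rewrite /co mxE.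
transitivity (g (phi x) W (J d x)).
  rewrite (g_suml _ _ cW); apply: eq_bigr => h _.
  by rewrite gcompU // gE.
rewrite gE /=; under eq_bigr do rewrite -/(co W _) cW curvU // /S3 mulr_suml.
rewrite exchange_big /=; apply: eq_bigr => p _.
under eq_bigr do rewrite -mulrA mulr_suml.
rewrite -mulr_sumr; congr (_ * _); rewrite exchange_big /=; apply: eq_bigr => q _.
under eq_bigr do rewrite -mulrA mulr_suml.
rewrite -mulr_sumr; congr (_ * _); rewrite exchange_big /=; apply: eq_bigr => r _.
under eq_bigr do rewrite -mulrA mulr_sumr.
rewrite -mulr_sumr; congr (_ * _); rewrite exchange_big /=; apply: eq_bigr => s _.
rewrite /Rcomp mulr_sumr; apply: eq_bigr => f _.
by rewrite mulrCA.
Qed.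

Definition natural n (T : tfield R k) := forall x, U x -> forall l, size l = n ->
  T x l = teval [seq derive phi x (ev a) | a <- l] (T (phi x)).

(** Differentiating the naturality of [T] produces a derivation along the second derivatives of
    [phi]. By [HE] these split into a source part [D1], which cancels the source correction, and a
    target part [D2], which is the correction of [covd] at [phi x]. *)
Let natural_covd n T : natural n T ->
  (forall l y, size l = n -> differentiable (fun y => T y l) y) ->
  natural n.+1 (covd F eps T).
Proof.
move=> nT dT x Ux l; case/lastP: l => [//|l b]; rewrite size_rcons => -[sl].
have dJx e : differentiable (J e) x by exact: dJ.
have dTx l' : size l' = size l -> differentiable (fun y => T y l') (phi x).
  by move=> sl'; apply: dT; rewrite sl'.
pose D1 a : pt R k := \row_e (\sum_c Gam F eps c b a x * co (J c x) e).
have cD1 a e : co (D1 a) e = \sum_c Gam F eps c b a x * co (J c x) e by rewrite /co mxE.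
pose D2 a : pt R k := GamV (phi x) (J b x) (J a x).
pose D3 c a : pt R k := \row_f (\sum_p co (J a x) p * Gam F eps f c p (phi x)).
have cD3 c a f : co (D3 c a) f =
    \sum_p co (J a x) p * Gam F eps f c p (phi x) by rewrite /co mxE.
rewrite covd_rcons /pd (derive_eqU (h := fun y =>
    teval [seq J a y | a <- l] (T (phi y))) _ Ux); last first.
  by move=> y Uy; exact: nT.
rewrite (hasD_derive (hasD_teval (ev b) (dphi Ux) dJx dTx)).
rewrite (@corr_ext _ _ _ _ _ (fun l => teval [seq J a x | a <- l] (T (phi x)))); last first.
  by move=> l' sl'; apply: nT => //; rewrite sl'.
rewrite (@corr_teval_der _ _ _ (J^~ x) D1) //.
rewrite (@teval_derB _ _ (J^~ x) D1 D2); last first.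
  by move=> a e; rewrite -/(H b a x) HE // cD1.
rewrite map_rcons teval_rcons (@teval_der_lin _ _ _ (co (J b x)) _ D2 D3); last first.
  by move=> a f; rewrite co_GamV /=; apply: eq_bigr => c _; rewrite cD3.
rewrite -addrA addrAC subrr add0r -sumrB; apply: eq_bigr => c _.
rewrite -mulrBr; congr (_ * _).
rewrite -(@teval_corr _ _ (fun p f => Gam F eps f c p (phi x)) (J^~ x) (D3 c)) //.
rewrite -[X in _ - X]mul1r -mulNr -tevalZ -tevalD; apply: teval_ext => l' sl'.
by rewrite covd_rcons mulN1r.
Qed.

Lemma natural_nablaR m : natural (4 + m) (nablaR F eps m).
Proof.
elim: m => [|m IH].
  move=> x Ux [|a [|b [|c [|d [|e l]]]]] //= _.
  exact: RcompU.
rewrite addnS; apply: natural_covd => // -[|a [|b [|c [|d l]]]] y //= [sl].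
exact: differentiable_nablaR.
Qed.

Lemma isometry_model_iso x m : U x ->
  exists M, model_iso F F eps m x (phi x) M.
Proof.
move=> Ux; exists (Mx x); split; first exact: Mx_unit.
  move=> X Y; rewrite -!/(g _ _ _) !g_mx trmx_mul -(Mx_gmat Ux).
  by rewrite !mulmxA.
move=> i _ Xs sXs; rewrite (@teval_mulmx _ _ _ (J^~ x)); last by move=> a c; rewrite mxE.
by apply: teval_ext => l sl; rewrite (natural_nablaR (m := i) Ux) // sl.
Qed.

End Isometry.

(** * Model isomorphisms and the theorem *)

Section Invariance.
Variables (R : realType) (k : nat) (eps : 'I_k -> R).
Hypothesis eps_pm : forall i, eps i = 1 \/ eps i = -1.

Lemma gamma_basis_indep (F : 'I_k -> R -> R) m P B B' : admissible F -> (2 <= m)%N ->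
  normalized F eps P B -> normalized F eps P B' -> gamma F eps m P B = gamma F eps m P B'.
Proof.
move=> [sF F1] m2 nB nB'.
by rewrite (gamma_normalized eps_pm sF F1 nB m2) (gamma_normalized eps_pm sF F1 nB' m2).
Qed.

Lemma model_iso_normalized (F F' : 'I_k -> R -> R) l P Q M B : model_iso F F' eps l P Q M ->
  normalized F eps P B ->
  normalized F' eps Q (fun a => ((B a : 'rV[R]_(Mdim k)) *m M : pt R k)).
Proof.
move=> [uM gM RM] [fB gB RB]; split.
- have -> : \matrix_a ((B a : 'rV[R]_(Mdim k)) *m M) =
    (\matrix_a (B a : 'rV[R]_(Mdim k))) *m M.
    apply/matrixP => a b; rewrite !mxE; apply: eq_bigr => c _.
    by rewrite !mxE.
  by rewrite row_free_unit unitmx_mul uM andbT -row_free_unit.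
- by move=> a b; rewrite gM gB.
- move=> a b c d; rewrite -(RB a b c d).
  exact: (RM 0%N (leq0n l) [:: B a; B b; B c; B d] erefl).
Qed.

(** [M] carries [B] to a normalized basis at [Q] with the same value of [gamma], and basis
    independence at [Q] replaces it by [B']. The orders involved are [p] and 1, both at most [l]. *)
Lemma gamma_model_iso (F F' : 'I_k -> R -> R) l p P Q M B B' :
  admissible F' -> (2 <= p <= l)%N -> model_iso F F' eps l P Q M ->
  normalized F eps P B -> normalized F' eps Q B' ->
  gamma F eps p P B = gamma F' eps p Q B'.
Proof.
move=> aF' /andP[p2 pl] iM nB nB'.
rewrite -(gamma_basis_indep aF' p2 (model_iso_normalized iM nB) nB').
have [_ _ RM] := iM.
apply: eq_bigr => j _; congr (_ * _ ^+ _).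
  have := RM p pl ([:: B (iU ord0); B (iU (lift ord0 j)); B (iU (lift ord0 j));
               B (iU ord0)] ++ nseq p (B (iU (lift ord0 j)))).
  by rewrite map_cat map_nseq => <- //; rewrite size_cat size_nseq.
exact: esym (RM 1%N (leq_trans (ltnW p2) pl) [:: B (iU ord0); B (iU (lift ord0 j));
    B (iU (lift ord0 j));
               B (iU ord0); B (iU (lift ord0 j))] erefl).
Qed.

Lemma gamma2E (F : 'I_k -> R -> R) P B : admissible F -> normalized F eps P B ->
  gamma F eps 2 P B = gamma2_formula F eps P.
Proof.
move=> [sF F1] nB; rewrite (gamma_normalized eps_pm sF F1 nB (leqnn 2)).
apply: eq_bigr => j _; rewrite subnn expr0 mulr1 /gcoef coefB2E // coefA2E //.
rewrite /ucoord -/(uj j) -/(co P (uj j)).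
have : derive1n 1 (F j) (co P (uj j)) + 1 != 0 by exact: F1.
rewrite -[derive1n 1 (F j)]/(derive1 (F j)).
move: (derive1 (F j) _) (derive1n 2 (F j) _) (derive1n 3 (F j) _) (F j _) => f1 f2 f3 f0 H.
by field.
Qed.

Lemma loc_hom_curv_hom (F : 'I_k -> R -> R) m : admissible F -> loc_hom F eps ->
    curv_hom F eps m.
Proof.
move=> [sF _] lh P Q; have [U [V [phi [psi [[oU _ UP _ PQ] [_ [sphi _ iso]]]]]]] := lh P Q.
by have := isometry_model_iso eps_pm sF oU sphi iso m UP; rewrite PQ.
Qed.

End Invariance.

Theorem theorem5p5 (R : realType) (k : nat) (eps : 'I_k -> R)
    (F : 'I_k -> R -> R) (l : nat) :
  (1 <= k)%N ->
  (forall i, eps i = 1 \/ eps i = -1) ->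
  admissible F ->
  (2 <= l)%N ->
  [/\
   (* (1a) independence of the normalized basis *)
   (forall (P : pt R k) (B B' : 'I_(Mdim k) -> pt R k),
      normalized F eps P B -> normalized F eps P B' ->
      gamma F eps l P B = gamma F eps l P B'),
   (* (1b) l-model invariance *)
   (forall (F' : 'I_k -> R -> R) (P Q : pt R k) (M : 'M[R]_(Mdim k))
           (B B' : 'I_(Mdim k) -> pt R k),
      admissible F' -> model_iso F F' eps l P Q M ->
      normalized F eps P B -> normalized F' eps Q B' ->
      gamma F eps l P B = gamma F' eps l Q B'),
   (* (2) formula for gamma_2 *)
   (forall (P : pt R k) (B : 'I_(Mdim k) -> pt R k),
      normalized F eps P B -> gamma F eps 2 P B = gamma2_formula F eps P),
   (* (3) l-curvature homogeneous => gamma_p constant, 2 <= p <= l *)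
   (curv_hom F eps l ->
      forall p, (2 <= p <= l)%N ->
      forall (P Q : pt R k) (B B' : 'I_(Mdim k) -> pt R k),
      normalized F eps P B -> normalized F eps Q B' ->
      gamma F eps p P B = gamma F eps p Q B') &
   (* (4) locally homogeneous => gamma_p constant for all p >= 2 *)
   (loc_hom F eps ->
      forall p, (2 <= p)%N ->
      forall (P Q : pt R k) (B B' : 'I_(Mdim k) -> pt R k),
      normalized F eps P B -> normalized F eps Q B' ->
      gamma F eps p P B = gamma F eps p Q B')].
Proof.
move=> k1 eps_pm aF l2; split.
- by move=> P B B'; exact: gamma_basis_indep.
- by move=> F' P Q M B B' aF'; apply: gamma_model_iso => //; rewrite l2 leqnn.
- by move=> P B; exact: gamma2E.
- move=> ch p pl P Q B B'; have [M iM] := ch P Q.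
  exact: gamma_model_iso iM.
(* A local isometry yields model isomorphisms of every order, so the order is taken to be [p]
   itself, which may exceed [l]. *)
- move=> lh p p2 P Q B B'; have [M iM] := loc_hom_curv_hom eps_pm p aF lh P Q.
  by apply: (gamma_model_iso eps_pm aF _ iM); rewrite p2 leqnn.
Qed.
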